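(* Let $\mathbb{K}$ be a field and let $G$ be a finite simple $1$-well-covered graph. Then $\gamma_0(G)=\gamma(G)={\rm deg}(J(G))$. In particular, for any even integer $k\geq 2$, $${\rm reg}(J(G)^{(k)})=k\,{\rm deg}(J(G)).$$
   Context: For $V(G)=\{x_1,\ldots,x_n\}$, let $S=\mathbb{K}[x_1,\ldots,x_n]$. The cover ideal is $J(G)=\bigcap_{x_ix_j\in E(G)}(x_i,x_j)$ and its $k$-th symbolic power is $J(G)^{(k)}=\bigcap_{x_ix_j\in E(G)}(x_i,x_j)^k$ (both equal $S$ if $G$ has no edges). The regularity of a graded $S$-module $M$ is ${\rm reg}(M)=\max\{j-i\mid \beta_{i,j}(M)\neq 0\}$. For a monomial ideal $I$, ${\rm deg}(I)$ is the maximum degree of its minimal monomial generators; thus ${\rm deg}(J(G))$ is the largest cardinality of a minimal vertex cover of $G$. Let $i(G)$ be the independence number of $G$ (maximum cardinality of an independent set). $G$ is well-covered if all its minimal vertex covers have the same cardinality; $G$ is $1$-well-covered if it is well-covered and, for every vertex $x\in V(G)$, the graph $G\setminus x$ is well-covered with $i(G\setminus x)=i(G)$. For a set $A$ of vertices, $N_G(A)=\bigcup_{x\in A}N_G(x)$ and $N_G[A]=N_G(A)\cup A$; $G\setminus B$ denotes the graph obtained by deleting the vertices in $B$. Define $$\gamma(G)=\max\Big\{\tfrac{|V(G)|+|N_G(A)|-|A|}{2}\;\Big|\; A \text{ is a (possibly empty) independent set of } G \text{ and } G\setminus N_G[A] \text{ has no bipartite connected component}\Big\},$$ where an isolated vertex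 counts as a bipartite connected component and the graph with no vertices has no connected components, and $$\gamma_0(G)=\max\Big\{\tfrac{|V(G)|+|N_G(A)|-|A|}{2}\;\Big|\; A \text{ is a (possibly empty) independent set of } G \text{ and any bipartite connected component of } G\setminus N_G[A] \text{ is an isolated vertex}\Big\}.$$ *)

(* Defs.v *)
From HB Require Import structures.
From mathcomp Require Import all_boot all_order all_algebra.
From mathcomp Require Import mpoly.
From Stdlib Require Import ClassicalEpsilon.

Set Implicit Arguments.
Unset Strict Implicit.
Unset Printing Implicit Defensive.

Import Order.TTheory GRing.Theory Num.Theory.
Local Open Scope ring_scope.

(* A simple graph is a symmetric irreflexive relation [e] on a finite type;   *)
(* notions taking a vertex set [W] refer to the induced subgraph on [W], so   *)
(* that the graph with the vertices of [B] deleted is the case [W = ~: B].    *)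

Section Graphs.
Variables (T : finType) (e : rel T).
Implicit Types (x y : T) (A B C W : {set T}).

Definition independent A : bool :=
  [forall x in A, forall y in A, ~~ e x y].

Definition indep_number W : nat :=
  \max_(A : {set T} | (A \subset W) && independent A) #|A|.

Definition vertex_cover W C : bool :=
  (C \subset W) &&
  [forall x in W, forall y in W, e x y ==> (x \in C) || (y \in C)].

Definition min_vertex_cover W C : bool := minset (vertex_cover W) C.

Definition well_covered W : Prop :=
  forall C C', min_vertex_cover W C -> min_vertex_cover W C' -> #|C| = #|C'|.

Definition one_well_covered : Prop :=
  well_covered [set: T] /\
  forall x, well_covered (~: [set x]) /\
            indep_number (~: [set x]) = indep_number [set: T].

Definition open_nbhd A : {set T} := [set y | [exists x in A, e x y]].

Definition closed_nbhd A : {set T} := open_nbhd A :|: A.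

Definition components W : {set {set T}} :=
  equivalence_partition
    (connect [rel x y | [&& x \in W, y \in W & e x y]]) W.

Definition bipartite C : bool :=
  [exists B : {set T}, forall x in C, forall y in C,
     e x y ==> ((x \in B) != (y \in B))].

Definition gamma_value A : rat :=
  (#|T|%:R + #|open_nbhd A|%:R - #|A|%:R) / 2.

Definition gamma_set A : bool :=
  independent A &&
  [forall C in components (~: closed_nbhd A), ~~ bipartite C].

Definition gamma0_set A : bool :=
  independent A &&
  [forall C in components (~: closed_nbhd A), bipartite C ==> (#|C| == 1)%N].

(* The default 0 of the maxima is harmless: the values are nonnegative, and   *)
(* both families contain every maximal independent set.                       *)
Definition gamma : rat :=
  \big[Num.max/0]_(A : {set T} | gamma_set A) gamma_value A.

Definition gamma0 : rat :=
  \big[Num.max/0]_(A : {set T} | gamma0_set A) gamma_value A.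

End Graphs.

(* The greatest element of [P], unspecified when there is none. *)
Definition maximum (P : int -> Prop) : int :=
  epsilon (inhabits 0) (fun m => P m /\ forall x, P x -> x <= m).

Section Ideals.
Variables (K : fieldType) (n : nat).
Local Notation S := {mpoly K[n]}.
Implicit Types (I G : S -> Prop) (f : S).

Definition ideal_gen G : S -> Prop := fun f =>
  exists (m : nat) (a g : 'I_m -> S),
    (forall i, G (g i)) /\ f = \sum_(i < m) a i * g i.

Definition ideal_power I (k : nat) : S -> Prop :=
  ideal_gen (fun f => exists g : 'I_k -> S,
    (forall i, I (g i)) /\ f = \prod_(i < k) g i).

Definition edge_prime (i j : 'I_n) : S -> Prop :=
  ideal_gen (fun f => f = 'X_i \/ f = 'X_j).

Definition cover_ideal (e : rel 'I_n) : S -> Prop := fun f =>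
  forall i j, e i j -> edge_prime i j f.

Definition cover_symbolic_power (e : rel 'I_n) (k : nat) : S -> Prop :=
  fun f => forall i j, e i j -> ideal_power (edge_prime i j) k f.

(* The minimal monomial generators of a monomial ideal are the monomials in   *)
(* it that are minimal for divisibility, i.e. for [lem] on exponents.         *)
Definition min_monomial_generator I (m : 'X_{1..n}) : Prop :=
  I 'X_[m] /\ forall m' : 'X_{1..n}, I 'X_[m'] -> (m' <= m)%MM -> m' = m.

Definition ideal_deg I : int :=
  maximum (fun d => exists m, min_monomial_generator I m /\ d = (mdeg m)%:Z).

(* Data of a graded complex of finite free modules                            *)
(*   ... -> F_2 -> F_1 -> F_0 -> S,   F_i = \bigoplus_a S(- gfc_shift i a),   *)
(* with elements of F_i written as row vectors, so that the maps are right    *)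
(* multiplications by [gfc_diff i : F_(i+1) -> F_i] and [gfc_aug : F_0 -> S]. *)
Record graded_free_complex := GradedFreeComplex {
  gfc_rank : nat -> nat;
  gfc_shift : forall i, 'I_(gfc_rank i) -> nat;
  gfc_diff : forall i, 'M[S]_(gfc_rank i.+1, gfc_rank i);
  gfc_aug : 'cV[S]_(gfc_rank 0)
}.

(* Maps homogeneous of degree 0, with the degree condition on the entries     *)
(* written additively to avoid truncated subtraction.                         *)
Definition gfc_homogeneous (F : graded_free_complex) : Prop :=
  (forall a, gfc_aug F a 0 \is (gfc_shift a).-homog) /\
  (forall i (a : 'I_(gfc_rank F i.+1)) (b : 'I_(gfc_rank F i)),
     {in msupp (gfc_diff F i a b), forall m,
        (mdeg m + gfc_shift b)%N = gfc_shift a}).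

(* Exactness of ... -> F_1 -> F_0 -> I -> 0. *)
Definition gfc_resolves (F : graded_free_complex) I : Prop :=
  [/\ forall f, I f <-> exists v : 'rV[S]_(gfc_rank F 0),
        v *m gfc_aug F = f%:M,
      forall v : 'rV[S]_(gfc_rank F 0),
        v *m gfc_aug F = 0 <-> exists w, v = w *m gfc_diff F 0
    & forall i (v : 'rV[S]_(gfc_rank F i.+1)),
        v *m gfc_diff F i = 0 <-> exists w, v = w *m gfc_diff F i.+1].

(* F_(i+1) is mapped into (x_1, ..., x_n) F_i. *)
Definition gfc_minimal (F : graded_free_complex) : Prop :=
  forall i a b, (gfc_diff F i a b)@_0%MM = 0.

Definition minimal_graded_free_resolution (F : graded_free_complex) I : Prop :=
  [/\ gfc_homogeneous F, gfc_resolves F I & gfc_minimal F].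

(* The number of summands S(-j) in the i-th module of a minimal graded free   *)
(* resolution of [I]; it does not depend on the resolution.                   *)
Definition betti I (i j : nat) : nat :=
  epsilon (inhabits 0%N) (fun b => exists F : graded_free_complex,
    minimal_graded_free_resolution F I /\
    b = #|[set a : 'I_(gfc_rank F i) | gfc_shift a == j]|).

Definition regularity I : int :=
  maximum (fun r => exists i j : nat,
    betti I i j <> 0%N /\ r = j%:Z - i%:Z).

End Ideals.

Arguments cover_ideal K [n] e _.
Arguments cover_symbolic_power K [n] e k _.

(* Main.v *)
Require Import Defs.
From HB Require Import structures.
From mathcomp Require Import all_boot all_order all_algebra.
From mathcomp Require Import mpoly zify ring.
From Stdlib Require Import ClassicalEpsilon.

(** Write alpha for the independence number, n for the number of vertices and
    d = n - alpha for the common size of the minimal vertex covers.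

    The two graph invariants rest on one inequality, [open_nbhd_bound]: an
    independent set A satisfies |N(A)| + 2 alpha <= n + |A|. It comes from the
    exchange property of 1-well-covered graphs: a vertex x of a maximum
    independent set can be traded for a neighbour of x. Extending A to two
    maximum independent sets and trading away their common vertices outside A
    leaves two such sets that meet only in A, and their union avoids N(A). So
    every value occurring in gamma or gamma_0 is at most d, and a maximum
    independent set reaches d.

    The regularity of the symbolic power I = J^(2k) is at least 2kd, because the
    2k-th power of the monomial of a minimal vertex cover is a minimal generator
    of I. For the upper bound, the module I is shown to have no Koszul homology
    in high degree: a Koszul cycle of homological degree i and multidegree b with
    |b| > 2kd + i is a boundary. The strand of the Koszul complex in multidegree
    b is the chain complex of the simplicial complex Delta_b of the sets A such
    that x^b divided by the product of the x_v, v in A, lies in I. Let P be the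
    set of vertices v with b_v <= k. The complex Delta_b is fibred over its faces
    X inside P, and a fibre has no homology as soon as some vertex q outside P
    can be added to all its faces ([fibrewise_cone_acyclic]). For |X| <= i the
    exponent c = b - X has |c| > 2kd. By [tight_cover_bound] (summing
    [open_nbhd_bound] over the level sets of c), some vertex q with c_q > k has
    no neighbour u with c_q + c_u = 2k; such a q works. Here it matters that the
    exponent 2k is even: two vertices outside P have a degree sum of at least
    2k + 2, so only neighbours in P can obstruct the addition of q, and those are
    controlled by X.

    Vanishing of Koszul cycles is passed from the image of a graded map to its
    kernel with the degree bound raised by one ([koszul_regular_ker]), and it
    bounds the degrees of minimal generators ([koszul_regular_shifts]). Hence
    every minimal graded free resolution of I has its i-th shifts at most
    2kd + i. The same property shows that each syzygy module is generated in
    bounded degrees, hence by finitely many elements, and so it also yields the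
    existence of a minimal resolution without an appeal to Noetherianity. *)

Set Implicit Arguments.
Unset Strict Implicit.
Unset Printing Implicit Defensive.

Import Order.TTheory GRing.Theory Num.Theory.
Local Open Scope ring_scope.

(** * Koszul differentials *)

Section Koszul.
Variables (n : nat) (R : comNzRingType) (V : lmodType R).
Implicit Types (s t q : 'I_n) (A B X : {set 'I_n}).

(** The sign of moving the basis vector of [s] from the front of the wedge of
    the basis vectors of [A], taken in increasing order, to its own place. *)
Definition kos_sign s A : R := (-1) ^+ #|[set t in A | (t < s)%N]|.

(** The Koszul differential of the sequence [x] on [V], all homological degrees
    at once: [w A] is the coefficient of the wedge of the [e_t], [t] in [A].
    For [x] constantly 1 it is the boundary of augmented simplicial chains. It
    is an unconditional formula, so chains on a subcomplex or with coefficients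
    in a submodule are the functions [w] whose values satisfy that condition. *)
Definition koszul (x : 'I_n -> R) (w : {set 'I_n} -> V) : {set 'I_n} -> V :=
  fun A => \sum_(s | s \notin A) (kos_sign s A * x s) *: w (s |: A).

Lemma kos_signU s t A : t \notin A ->
  kos_sign s (t |: A) = (-1) ^+ (t < s)%N * kos_sign s A.
Proof.
move=> tA; rewrite /kos_sign; case ts: (t < s)%N.
  rewrite (_ : [set u in t |: A | _] = t |: [set u in A | (u < s)%N]).
    by rewrite cardsU1 !inE (negPf tA) /= exprD.
  by apply/setP=> u; rewrite !inE; case: eqP => [->|].
rewrite mul1r; congr (_ ^+ #|pred_of_set _|).
by apply/setP=> u; rewrite !inE; case: eqP => [->|//]; rewrite ts (negPf tA).
Qed.

Lemma kos_sign_sqr s A : kos_sign s A * kos_sign s A = 1.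
Proof. by rewrite /kos_sign -expr2 sqrr_sign. Qed.

Lemma kos_sign_swap s t A : s != t -> s \notin A -> t \notin A ->
  kos_sign s A * kos_sign t (s |: A) = - (kos_sign t A * kos_sign s (t |: A)).
Proof.
move=> st sA tA; rewrite !kos_signU // mulrCA [in RHS]mulrCA.
rewrite [kos_sign t A * _]mulrC -mulNr; congr (_ * _).
move: st; rewrite -val_eqE neq_ltn => /orP[] st; rewrite st ltnNge (ltnW st) /=.
  by rewrite expr0 expr1.
by rewrite expr0 expr1 opprK.
Qed.

(** The terms indexed by [(s, t)] and [(t, s)] cancel. They are paired through
    the order of the indices, since equality with its own opposite says nothing
    in characteristic 2. *)
Lemma koszul_koszul x w A : koszul x (koszul x w) A = 0.
Proof.
pose f s t := (kos_sign s A * x s * (kos_sign t (s |: A) * x t))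
                *: w (t |: (s |: A)).
pose P s t := (s \notin A) && (t \notin s |: A).
have Psym s t : P s t = P t s.
  rewrite /P !inE !negb_or eq_sym.
  by case: (s \notin A); case: (t \notin A); rewrite ?andbF ?andbT.
have fN s t : P s t -> f s t + f t s = 0.
  case/andP=> sA; rewrite !inE negb_or => /andP[ts tA]; rewrite /f setUCA.
  rewrite -scalerDl mulrACA kos_sign_swap // 1?eq_sym //.
  rewrite [kos_sign t A * x t * _]mulrACA (mulrC (x t)) mulNr addNr scale0r //.
have -> : koszul x (koszul x w) A = \sum_(p | P p.1 p.2) f p.1 p.2.
  rewrite /koszul -(pair_big_dep (fun s => s \notin A)
    (fun s t => t \notin s |: A) f) /=.
  by apply: eq_bigr => s sA; rewrite scaler_sumr; apply: eq_bigr => t _; rewrite scalerA.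
rewrite (bigID (fun p : 'I_n * 'I_n => (p.1 < p.2)%N)) /=.
rewrite [X in _ + X](reindex_inj (h := fun p : 'I_n * 'I_n => (p.2, p.1))) /=; last first.
  by move=> [a b] [c d] [-> ->].
rewrite [X in _ + X](eq_bigl (fun p => P p.1 p.2 && (p.1 < p.2)%N)); last first.
  move=> [s t] /=; rewrite Psym -leqNgt; case Pst: (P s t) => //=.
  move: Pst; rewrite /P !inE negb_or -val_eqE /= eq_sym leq_eqVlt.
  by case: eqP => //; rewrite andbF.
by rewrite -big_split /= big1 // => -[s t] /andP[/fN].
Qed.

Lemma koszulB x w1 w2 A :
  koszul x (fun B => w1 B - w2 B) A = koszul x w1 A - koszul x w2 A.
Proof. by rewrite /koszul -sumrB; apply: eq_bigr => s _; rewrite scalerBr. Qed.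

Lemma koszulD x w1 w2 A :
  koszul x (fun B => w1 B + w2 B) A = koszul x w1 A + koszul x w2 A.
Proof. by rewrite /koszul -big_split; apply: eq_bigr => s _; rewrite /= scalerDr. Qed.

Lemma koszul_sum (I : finType) x (w : I -> {set 'I_n} -> V) A :
  koszul x (fun B => \sum_j w j B) A = \sum_j koszul x (w j) A.
Proof.
by rewrite /koszul exchange_big; apply: eq_bigr => s _; rewrite scaler_sumr.
Qed.

Lemma eq_koszul x w1 w2 : w1 =1 w2 -> koszul x w1 =1 koszul x w2.
Proof. by move=> ww A; apply: eq_bigr => s _; rewrite ww. Qed.

Lemma koszul0 x A : koszul x (fun=> 0) A = 0.
Proof. by rewrite /koszul big1 // => s _; rewrite scaler0. Qed.

(** Wedging with the basis vector of [q]: the cone with apex [q]. *)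
Definition coning q (w : {set 'I_n} -> V) : {set 'I_n} -> V :=
  fun A => if q \in A then kos_sign q (A :\ q) *: w (A :\ q) else 0.

Lemma coning_homotopy q w A :
  koszul (fun=> 1) (coning q w) A + coning q (koszul (fun=> 1) w) A = w A.
Proof.
rewrite {2}/coning; case: ifPn => qA.
  set B := A :\ q; have qB : q \notin B by rewrite !inE eqxx.
  have AE : A = q |: B by rewrite setD1K.
  rewrite /koszul [X in _ + _ *: X](bigD1 q) //= scalerDr scalerA mulr1.
  rewrite kos_sign_sqr scale1r -AE addrCA -[RHS]addr0; congr (_ + _).
  rewrite scaler_sumr.
  rewrite (eq_bigl (fun s => (s \notin B) && (s != q))); last first.
    by move=> s; rewrite AE !inE negb_or andbC; case: eqP => //= _; rewrite andbF.
  rewrite -big_split big1 //= => s /andP[sB sq].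
  rewrite /coning in_setU1 qA orbT !mulr1.
  have -> : (s |: A) :\ q = s |: B.
    apply/setP=> u; rewrite AE !inE; case: (u =P q) => [->|//] /=.
    by rewrite eq_sym (negPf sq).
  rewrite !scalerA -scalerDl AE !kos_signU // mulrACA.
  rewrite [kos_sign q B * _]mulrC.
  rewrite (_ : (-1) ^+ _ * _ = -1 :> R) ?mulN1r ?addNr ?scale0r //.
  move: sq; rewrite -val_eqE neq_ltn => /orP[] st; rewrite st ltnNge (ltnW st) /=.
    by rewrite !(expr0, expr1, mulr1, mul1r).
  by rewrite !(expr0, expr1, mulr1, mul1r).
rewrite addr0 /koszul (bigD1 q) //= big1 ?addr0 => [|s /andP[sA sq]].
  by rewrite /coning setU11 mulr1 setU1K // scalerA kos_sign_sqr scale1r.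
by rewrite /coning !inE eq_sym (negPf sq) (negPf qA) scaler0.
Qed.

End Koszul.

(** * Acyclicity of simplicial chains *)

Section SimplicialChains.
Variables (n : nat) (R : comNzRingType) (V : lmodType R).
Implicit Types (D : pred {set 'I_n}) (A B X P : {set 'I_n}).

Local Notation boundary := (koszul (fun=> 1 : R)).

Definition chain D i (c : {set 'I_n} -> V) :=
  forall A, ~~ (D A && (#|A| == i)) -> c A = 0.

(** Here [#|A| = i], so that [i] is one more than the dimension of [A]; the
    empty face, of size 0, carries the augmentation. *)
Definition acyclic_at D i :=
  forall c, chain D i c -> boundary c =1 (fun=> 0) ->
  exists2 y, chain D i.+1 y & boundary y =1 c.

Lemma chain_boundary D i y :
  (forall A B, A \subset B -> D B -> D A) ->
  chain D i.+1 y -> chain D i (boundary y).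
Proof.
move=> Ddown yD A DA; rewrite /koszul big1 // => s sA.
rewrite yD ?scaler0 //; apply: contra DA => /andP[/(Ddown _ _ (subsetUr _ _)) -> /=].
by rewrite cardsU1 sA.
Qed.

(** Coning the part of [c] lying over [X] is a contraction of that part, up to
    the cone over its boundary. Over the faces whose [P]-part has the maximal
    size [u], that boundary is 0 or the boundary of the whole cycle [c], hence
    vanishes. *)
Lemma fibre_cone D P i u (c : {set 'I_n} -> V) X q :
  chain D i c -> boundary c =1 (fun=> 0) ->
  (forall A, (u < #|A :&: P|)%N -> c A = 0) ->
  q \notin P -> (forall A, D A -> A :&: P = X -> D (q |: A)) ->
  let cX A := if A :&: P == X then c A else 0 in
  chain D i.+1 (coning q cX) /\
  forall A, (u <= #|A :&: P|)%N -> boundary (coning q cX) A = cX A.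
Proof.
move=> cD c0 cu qP qD cX; split=> [A DA|A uA].
  rewrite /coning; case: ifP => // qA; rewrite /cX; case: eqP => [AX|]; last by rewrite scaler0.
  rewrite cD ?scaler0 //; apply: contra DA => /andP[DA /eqP cA].
  by rewrite -(setD1K qA) qD //= cardsU1 cA !inE eqxx.
have := coning_homotopy q cX A; set Y := (X in _ + X = _).
suff -> : Y = 0 by rewrite addr0.
rewrite {}/Y /coning; case: ifP => // qA.
have : (u <= #|(A :\ q) :&: P|)%N.
  rewrite (_ : _ :&: P = A :&: P) //; apply/setP=> v; rewrite !inE.
  by case: eqP => // ->; rewrite (negPf qP) !andbF.
move: (A :\ q) => B {A uA qA} uB; rewrite (_ : koszul _ _ _ = 0) ?scaler0 //.
have cP s : s \notin B -> s \in P -> c (s |: B) = 0.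
  move=> sB sP; apply: cu; rewrite setIUl (setIidPl _) ?sub1set //.
  by rewrite cardsU1 inE (negPf sB) /= add1n ltnS.
case: (B :&: P =P X) => BX.
  rewrite -(c0 B); apply: eq_bigr => s sB; congr (_ *: _); rewrite /cX.
  case: eqP => // sX; case sP: (s \in P); first by rewrite cP.
  case: sX; rewrite -BX; apply/setP=> v; rewrite !inE.
  by case: eqP => // ->; rewrite sP !andbF.
rewrite /koszul big1 // => s sB; rewrite /cX; case: eqP => sX; last by rewrite scaler0.
case sP: (s \in P); first by rewrite cP ?scaler0.
case: BX; rewrite -sX; apply/setP=> v; rewrite !inE.
by case: eqP => // ->; rewrite sP !andbF.
Qed.

(** A complex fibred over its faces contained in [P], with cones as fibres over
    the small ones. The apex depends on the fibre, so the cones do not fit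
    together to a contraction; they do so modulo faces with a smaller [P]-part,
    and descending induction on the size of the [P]-part finishes the proof. *)
Theorem fibrewise_cone_acyclic D P i :
  (forall A B, A \subset B -> D B -> D A) ->
  (forall X, X \subset P -> (#|X| <= i)%N -> D X ->
     exists2 q, q \notin P & forall A, D A -> A :&: P = X -> D (q |: A)) ->
  acyclic_at D i.
Proof.
move=> Ddown cone c cD c0.
have [t cu] : exists t, forall A, (t <= #|A :&: P|)%N -> c A = 0.
  exists #|P|.+1 => A PA; suff: false by []. 
  by move: PA; rewrite ltnNge subset_leq_card ?subsetIr.
elim: t c cD c0 cu => [|u IHu] c cD c0 cu.
  exists (fun=> 0); first by [].
  by move=> A; rewrite koszul0 cu.
(* [y X] contracts the part of [c] over [X], up to smaller [P]-parts. *)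
have [y yP] : exists y : {set 'I_n} -> {set 'I_n} -> V, forall X,
    chain D i.+1 (y X) /\ forall A, (u <= #|A :&: P|)%N ->
      boundary (y X) A = if A :&: P == X then c A else 0.
  apply: (fin_all_exists (P := fun X yX => chain D i.+1 yX /\ forall A, (u <= #|A :&: P|)%N ->
      boundary yX A = if A :&: P == X then c A else 0)) => X.
  case XP: [&& X \subset P, (#|X| <= i)%N & D X].
    have /and3P[XP1 XP2 XP3] := XP.
    have [q qP qD] := cone _ XP1 XP2 XP3.
    by exists (coning q (fun A => if A :&: P == X then c A else 0)); apply: fibre_cone.
  exists (fun=> 0); split=> // A uA; rewrite koszul0; case: eqP => // AX.
  apply/esym/cD; apply: contraFN XP => /andP[DA /eqP <-].
  rewrite -AX subsetIr subset_leq_card ?subsetIl //=.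
  exact: Ddown (subsetIl A P) DA.
pose Y A := \sum_X y X A.
have YD : chain D i.+1 Y.
  by move=> A DA; rewrite /Y big1 // => X _; case: (yP X) => ->.
have BY A : boundary Y A = \sum_X boundary (y X) A by rewrite koszul_sum.
case: (IHu (fun A => c A - boundary Y A)) => [A DA|A|A uA|z zD zc].
- by rewrite cD ?(chain_boundary Ddown YD) ?subr0.
- by rewrite koszulB c0 koszul_koszul subr0.
- rewrite BY (eq_bigr (fun X => if A :&: P == X then c A else 0)) => [|X _].
    by rewrite -big_mkcond (big_pred1 (A :&: P)) ?subrr // => X; rewrite eq_sym.
  by case: (yP X) => _ ->.
exists (fun A => z A + Y A) => [A DA|A]; first by rewrite zD ?YD ?addr0.
by rewrite koszulD zc subrK.
Qed.

End SimplicialChains.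

(** * The Koszul complex of a monomial ideal *)

Section MonomialKoszul.
Variables (n : nat) (K : fieldType).
Implicit Types (m b : 'X_{1..n}) (A B : {set 'I_n}) (s : 'I_n).
Local Notation S := {mpoly K[n]}.

Definition mset A : 'X_{1..n} := [multinom (s \in A : nat) | s < n].

Lemma mdeg_mset A : mdeg (mset A) = #|A|.
Proof.
by rewrite mdegE -sum1_card [RHS]big_mkcond; apply: eq_bigr => s _; rewrite mnmE; case: (s \in A).
Qed.

Lemma msetU1 s A : s \notin A -> mset (s |: A) = (mset A + U_(s))%MM.
Proof.
move=> sA; apply/mnmP=> t; rewrite mnmDE !mnmE !inE eq_sym addnC.
by case: eqP => [<-|_] //; rewrite (negPf sA).
Qed.

Lemma mcoeff_mulXU s (f : S) m :
  ('X_s * f)@_m = if (0 < m s)%N then f@_(m - U_(s))%MM else 0.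
Proof.
rewrite mulrC; case: ifP => ms.
  have sm : (U_(s) <= m)%MM by rewrite lep1mP -lt0n.
  by rewrite -{1}(submK sm) addmC mcoeffMX.
apply: memN_msupp_eq0; apply: contraFN ms => /msuppM_le/allpairsP[[m1 m2] /=].
by case=> _; rewrite msuppX inE => /eqP -> ->; rewrite mnmDE mnm1E eqxx addn1.
Qed.

Lemma kos_signC s A : kos_sign S s A = (kos_sign K s A)%:MP.
Proof. by rewrite /kos_sign rmorph_sign. Qed.

Lemma mcoeff_koszul (w : {set 'I_n} -> S^o) A m :
  (koszul (fun s => 'X_s : S) w A)@_m =
  \sum_(s | s \notin A)
     kos_sign K s A * (if (0 < m s)%N then (w (s |: A))@_(m - U_(s))%MM else 0).
Proof.
rewrite /koszul raddf_sum; apply: eq_bigr => s _ /=.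
by rewrite kos_signC /GRing.scale /= -mulrA mcoeffCM mcoeff_mulXU.
Qed.

(** The multidegree-[b] part of [w], read as a chain with scalar coefficients:
    in the Koszul complex, the wedge over [A] carries the degree of [mset A]. *)
Definition strand (w : {set 'I_n} -> S^o) b : {set 'I_n} -> K^o :=
  fun A => if (mset A <= b)%MM then (w A)@_(b - mset A)%MM else 0.

Lemma mset_sub_gt0 A b s : s \notin A -> (mset A <= b)%MM ->
  (mset (s |: A) <= b)%MM = (0 < (b - mset A)%MM s)%N.
Proof.
move=> sA /mnm_lepP Ab; rewrite msetU1 // mnmBE subn_gt0.
apply/mnm_lepP/idP => [/(_ s)|lt_s t]; first by rewrite mnmDE mnm1E eqxx addn1.
by rewrite mnmDE mnm1E; case: eqP => [<-|_]; rewrite ?addn1 // addn0.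
Qed.

Lemma koszul_strand w b A : (mset A <= b)%MM ->
  koszul (fun=> 1 : K) (strand w b) A =
  (koszul (fun s => 'X_s : S) w A)@_(b - mset A)%MM.
Proof.
move=> Ab; rewrite mcoeff_koszul; apply: eq_bigr => s sA.
rewrite mulr1; congr (_ * _); rewrite /strand mset_sub_gt0 //.
by case: ifP => // _; rewrite msetU1 // submDA.
Qed.

(** The Koszul complex of a monomial ideal splits into its strands, and the
    strand of multidegree [b] is a simplicial chain complex. The total degree
    of the strands involved exceeds [D + i], whence the degree bound on [y]. *)
Lemma monomial_koszul_exact (I : pred 'X_{1..n}) D i :
  (forall b, (D + i < mdeg b)%N ->
     @acyclic_at n K K^o
       (fun A => (mset A <= b)%MM && I (b - mset A)%MM) i) ->
  forall w : {set 'I_n} -> S^o,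
  (forall A m, m \in msupp (w A) -> I m && (D < mdeg m)%N) ->
  (forall A, #|A| != i -> w A = 0) ->
  koszul (fun s => 'X_s : S) w =1 (fun=> 0) ->
  exists y : {set 'I_n} -> S^o,
  [/\ forall A m, m \in msupp (y A) -> I m && (D <= mdeg m)%N,
      forall A, #|A| != i.+1 -> y A = 0
    & koszul (fun s => 'X_s : S) y =1 w].
Proof.
move=> acyc w wI wi w0.
(* Only the strands of multidegree below [N] are nonzero, which makes the
   sum defining the bounding chain finite. *)
pose N := (\max_A msize (w A) + i)%N.
have wN A m : (N <= mdeg (m + mset A))%N -> (w A)@_m = 0.
  move=> Nm; case: (#|A| =P i) => [Ai|/eqP/wi ->]; last by rewrite mcoeff0.
  apply/eqP; rewrite mcoeff_eq0; apply: msize_mdeg_ge.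
  apply: leq_trans (leq_bigmax (F := fun B => msize (w B)) A) _; move: Nm.
  by rewrite mdegD mdeg_mset Ai leq_add2r.
have strand0 b : ~~ (D + i < mdeg b < N)%N -> strand w b =1 (fun=> 0).
  move=> bN A; rewrite /strand; case: ifP => // Ab; apply/eqP; rewrite mcoeff_eq0.
  apply: contra bN => mw; have := wI _ _ mw => /andP[_ Dm].
  have Ai : #|A| = i.
    by apply/eqP; apply: contraLR mw => /wi ->; rewrite msupp0.
  rewrite -(submK Ab); apply/andP; split.
    by rewrite mdegD mdeg_mset Ai ltn_add2r.
  by rewrite ltnNge; apply: contraL mw => /wN/eqP; rewrite mcoeff_eq0.
pose Del b := fun A => (mset A <= b)%MM && I (b - mset A)%MM.
have yP b : exists y : {set 'I_n} -> K^o, [/\ chain (Del b) i.+1 y,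
    koszul (fun=> 1 : K) y =1 strand w b
    & ~~ (D + i < mdeg b < N)%N -> y =1 (fun=> 0)].
  case bN: (D + i < mdeg b < N)%N; last first.
    exists (fun=> 0); split=> // A; rewrite koszul0 strand0 ?bN //.
  have /andP[Db _] := bN.
  case: (acyc b Db (strand w b)) => [A|A|y yD yb]; last by exists y; split.
    rewrite /strand; case: ifP => //= Ab AI; apply/eqP; rewrite mcoeff_eq0.
    apply: contra AI => mw; have /andP[-> _] := wI _ _ mw.
    by apply: contraLR mw => /wi ->; rewrite msupp0.
  case Ab: (mset A <= b)%MM; first by rewrite koszul_strand // w0 mcoeff0.
  rewrite /koszul big1 // => s sA; rewrite /strand ifF ?scaler0 //.
  apply: contraFF Ab => /(lepm_trans _); apply.
  by rewrite msetU1 // lem_addr.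
pose y b := proj1_sig (constructive_indefinite_description _ (yP b)).
have ybP b : [/\ chain (Del b) i.+1 (y b),
    koszul (fun=> 1 : K) (y b) =1 strand w b
    & ~~ (D + i < mdeg b < N)%N -> y b =1 (fun=> 0)].
  by rewrite /y; case: constructive_indefinite_description.
pose Y A : S := \sum_(m : 'X_{1..n < N}) (y (m + mset A)%MM A *: 'X_[m]).
have YE A m : (Y A)@_m = y (m + mset A)%MM A.
  case: (ltnP (mdeg m) N) => mN; first exact: (mcoeff_mpoly (fun m => y (m + mset A)%MM A)).
  case: (ybP (m + mset A)%MM) => _ _ ->; last first.
    by rewrite negb_and -(leqNgt N) mdegD (leq_trans mN) ?leq_addr ?orbT.
  rewrite raddf_sum big1 // => k _ /=; rewrite mcoeffZ mcoeffX.
  case: eqP => [km|]; last by rewrite mulr0.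
  by move: mN; rewrite -km leqNgt bmdeg.
exists Y; split=> [A m|A Ai|A].
- rewrite mcoeff_msupp YE; case: (ybP (m + mset A)%MM) => yD _ y0.
  case: (boolP (Del (m + mset A)%MM A && (#|A| == i.+1))); last first.
    by move/yD => ->; rewrite eqxx.
  rewrite /Del addmK => /andP[/andP[_ ->] /eqP Ai].
  case: (boolP (D + i < mdeg (m + mset A) < N)%N); last first.
    by move/y0 => ->; rewrite eqxx.
  by rewrite mdegD mdeg_mset Ai addnS ltnS leq_add2r => /andP[].
- apply/mpolyP=> m; rewrite YE mcoeff0; case: (ybP (m + mset A)%MM) => -> //.
  by rewrite (negPf Ai) andbF.
apply/mpolyP=> m; pose b := (m + mset A)%MM.
have -> : (w A)@_m = strand w b A by rewrite /strand lem_addl addmK.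
case: (ybP b) => yD <- _; rewrite mcoeff_koszul; apply: eq_bigr => s sA.
rewrite mulr1 /GRing.scale /=; congr (_ * _).
case: ifP => ms.
  rewrite YE msetU1 // /b; congr (y _ _); rewrite [(mset A + _)%MM]addmC addmA.
  by rewrite submK // lep1mP -lt0n.
apply/esym/yD; rewrite /Del mset_sub_gt0 ?lem_addl // addmK ms //.
Qed.

End MonomialKoszul.

Section Supported.
Variables (n : nat) (K : fieldType).
Local Notation S := {mpoly K[n]}.
Implicit Types (m : 'X_{1..n}) (f g : S).

Definition supported (P : pred 'X_{1..n}) f := {in msupp f, forall m, P m}.

Lemma supported_sum (I : Type) (r : seq I) (P : pred 'X_{1..n}) (F : I -> S) :
  (forall i, supported P (F i)) -> supported P (\sum_(i <- r) F i).
Proof.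
move=> PF; apply: big_ind => // [m|f g Pf Pg m]; first by rewrite msupp0.
by move/msuppD_le; rewrite mem_cat => /orP[/Pf|/Pg].
Qed.

Lemma supportedM (P Q PQ : pred 'X_{1..n}) f g :
  (forall m1 m2, P m1 -> Q m2 -> PQ (m1 + m2)%MM) ->
  supported P f -> supported Q g -> supported PQ (f * g).
Proof.
move=> PQM Pf Qg m /msuppM_le/allpairsP[[m1 m2] /= [/Pf m1P /Qg m2Q ->]].
exact: PQM.
Qed.

Lemma supportedX (P : pred 'X_{1..n}) m : supported P ('X_[m] : S) <-> P m.
Proof.
split=> [|Pm m']; first by apply; rewrite msuppX inE.
by rewrite msuppX inE => /eqP ->.
Qed.

End Supported.

(** * Regularity through Koszul cycles *)

Section GradedModules.
Variables (n : nat) (K : fieldType).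
Local Notation S := {mpoly K[n]}.
Implicit Types (m : 'X_{1..n}) (A B : {set 'I_n}) (r p : nat) (f g : S).

Local Notation kosX := (koszul (fun s => 'X_s : S)).

(** Degrees are counted with the shifts [sh] of the free module. *)
Definition above r (sh : 'I_r -> nat) rho (v : 'rV[S]_r) :=
  forall a m, m \in msupp (v 0 a) -> (rho < mdeg m + sh a)%N.

Definition homog_vec r (sh : 'I_r -> nat) j (v : 'rV[S]_r) :=
  forall a m, m \in msupp (v 0 a) -> (mdeg m + sh a)%N = j.

Definition homog_mx r p (rs : 'I_r -> nat) (cs : 'I_p -> nat) (M : 'M[S]_(r, p)) :=
  forall a b, {in msupp (M a b), forall m, (mdeg m + cs b)%N = rs a}.

Definition img r p (M : 'M[S]_(r, p)) (z : 'rV[S]_p) := exists v, z = v *m M.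

(** The kernel lies in the irrelevant maximal ideal times the free module: the
    rows of [M] are a minimal system of generators of their span. *)
Definition min_ker r p (M : 'M[S]_(r, p)) :=
  forall v : 'rV[S]_r, v *m M = 0 -> forall a, (v 0 a)@_0%MM = 0.

(** For a graded submodule [Z] this says that its Koszul homology in position
    [i] vanishes in total degrees above [rho + i], that is, that [Z] is
    [rho]-regular. It is phrased with lower bounds on degrees, rather than with
    homogeneous chains, and it puts no degree condition on the bounding chain:
    this spares decomposing chains into homogeneous components. *)
Definition koszul_regular r (sh : 'I_r -> nat) (Z : 'rV[S]_r -> Prop) rho :=
  forall i (w : {set 'I_n} -> 'rV[S]_r),
  (forall A, Z (w A)) -> (forall A, #|A| != i -> w A = 0) ->
  (forall A, above sh rho (w A)) -> kosX w =1 (fun=> 0) ->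
  exists2 y, (forall A, Z (y A)) & kosX y =1 w.

Lemma eq_koszul_regular r (sh : 'I_r -> nat) Z Z' rho :
  (forall v, Z v <-> Z' v) -> koszul_regular sh Z rho -> koszul_regular sh Z' rho.
Proof.
move=> ZZ' regZ i w wZ wi wab w0.
have [|y yZ yw] := regZ i w _ wi wab w0; first by move=> A; apply/ZZ'.
by exists y => // A; apply/ZZ'.
Qed.

Lemma koszul_coord r (w : {set 'I_n} -> 'rV[S]_r) A a :
  kosX w A 0 a = kosX (fun B => w B 0 a : S^o) A.
Proof. by rewrite /koszul summxE; apply: eq_bigr => s _; rewrite mxE. Qed.

Lemma koszul_coord_const r (w : {set 'I_n} -> 'rV[S]_r) A a :
  (kosX w A 0 a)@_0%MM = 0.
Proof.
by rewrite koszul_coord mcoeff_koszul big1 // => s _; rewrite mnm0E mulr0.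
Qed.

Lemma koszul_mulmx r p (w : {set 'I_n} -> 'rV[S]_r) (M : 'M[S]_(r, p)) A :
  kosX (fun B => w B *m M) A = kosX w A *m M.
Proof.
by rewrite /koszul mulmx_suml; apply: eq_bigr => s _; rewrite scalemxAl.
Qed.

(** For a free module every strand is a full simplex on a nonempty set, since
    the degree condition and the bound on the shifts exclude constant terms. *)
Lemma free_koszul_exact r (sh : 'I_r -> nat) rho i (w : {set 'I_n} -> 'rV[S]_r) :
  (forall a, (sh a <= rho)%N) -> (forall A, #|A| != i -> w A = 0) ->
  (forall A, above sh rho.+1 (w A)) -> kosX w =1 (fun=> 0) ->
  exists y : {set 'I_n} -> 'rV[S]_r,
  [/\ forall A, above sh rho (y A), forall A, #|A| != i.+1 -> y A = 0
    & kosX y =1 w].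
Proof.
move=> shr wi wab w0.
have ya a : exists y : {set 'I_n} -> S^o,
    [/\ forall A m, m \in msupp (y A) -> predT m && (rho.+1 - sh a <= mdeg m)%N,
        forall A, #|A| != i.+1 -> y A = 0
      & kosX y =1 fun A => w A 0 a].
  apply: (monomial_koszul_exact (i := i)) => [b Db|A m mw|A Ai|A].
  - apply: (@fibrewise_cone_acyclic _ _ _ _ set0) => [A B /subsetP AB|X _ _ _].
      rewrite /= !andbT => /mnm_lepP Bb; apply/mnm_lepP=> v; apply: leq_trans (Bb v).
      by rewrite !mnmE; case vA: (v \in A) => //; rewrite AB.
    have [q bq] : exists q, (0 < b q)%N.
      apply/existsP; apply: contraLR Db; rewrite negb_exists => /forallP b0.
      rewrite mdegE big1 // => v _; have := b0 v; lia.
    exists q; first by rewrite inE.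
    move=> A; rewrite /= !andbT => /mnm_lepP Ab _; apply/mnm_lepP=> v.
    by have := Ab v; rewrite !mnmE !inE; case: eqP => [->|].
  - by have := wab A a m mw; have := shr a; rewrite /=; lia.
  - by rewrite wi // mxE.
  by rewrite -koszul_coord w0 mxE.
have [y yP] := fin_all_exists ya.
exists (fun A => \row_a y a A); split=> [A a m|A Ai|A].
- by rewrite mxE; case: (yP a) => /(_ A m) h _ _ /h /=; have := shr a; lia.
- by apply/rowP=> a; rewrite !mxE; case: (yP a) => _ ->.
apply/rowP=> a; rewrite koszul_coord; have [_ _ yw] := yP a.
by apply: etrans (yw A); apply: eq_koszul => B; rewrite mxE.
Qed.

Lemma above_mulmx r p rs cs (M : 'M[S]_(r, p)) rho v :
  homog_mx rs cs M -> above rs rho v -> above cs rho (v *m M).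
Proof.
move=> hM av b; rewrite mxE.
apply: (@supported_sum n K _ _ (fun m => (rho < mdeg m + cs b)%N)) => a.
apply: (supportedM (P := fun m => (rho < mdeg m + rs a)%N)
  (Q := fun m => (mdeg m + cs b == rs a)%N)) => [m1 m2|m|m].
- by rewrite mdegD => h /eqP; lia.
- exact: av.
- by move/hM => ->.
Qed.

(** The connecting homomorphism for [0 -> ker M -> F -> img M -> 0], chased by
    hand: a cycle in the kernel bounds in the free module [F] some [y]; the image
    of [y] is a cycle one step higher, hence bounds, and correcting [y] by a lift
    moves it into the kernel. *)
Lemma koszul_regular_ker r p rs cs (M : 'M[S]_(r, p)) rho :
  homog_mx rs cs M -> (forall a, (rs a <= rho)%N) ->
  koszul_regular cs (img M) rho ->
  koszul_regular rs (fun v => v *m M = 0) rho.+1.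
Proof.
move=> hM rsr regM i w wM wi wab w0.
have [y [yab yi yw]] := free_koszul_exact rsr wi wab w0.
have [|A Ai|A|A|u uM uy] := regM i.+1 (fun A => y A *m M).
- by move=> A; exists (y A).
- by rewrite yi // mul0mx.
- exact: above_mulmx hM (yab A).
- by rewrite koszul_mulmx yw wM.
have [t tP] := fin_all_exists uM.
exists (fun A => y A - kosX t A) => A.
  rewrite mulmxBl -koszul_mulmx -uy; apply/eqP; rewrite subr_eq0; apply/eqP.
  by apply: eq_koszul => B; rewrite tP.
by rewrite koszulB koszul_koszul subr0.
Qed.

Definition at_empty r (z : 'rV[S]_r) A := if A == set0 then z else 0.

(** In position 0 the property says that elements of high degree are in the
    irrelevant ideal times [Z]. *)
Lemma koszul_regular0 r (sh : 'I_r -> nat) Z rho z : Z 0 ->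
  koszul_regular sh Z rho -> Z z -> above sh rho z ->
  exists2 y, (forall A, Z (y A)) & kosX y set0 = z.
Proof.
move=> Z0 regZ Zz az; have [A|A A0|A|A|y yZ yw] := regZ 0%N (at_empty z).
- by rewrite /at_empty; case: eqP.
- by rewrite /at_empty -cards_eq0 (negPf A0).
- by rewrite /at_empty; case: eqP => // _ a m; rewrite mxE msupp0.
- rewrite /koszul big1 // => s sA; rewrite /at_empty ifF ?scaler0 //.
  by apply/negP=> /eqP/setP/(_ s); rewrite !inE eqxx.
by exists y; rewrite // yw /at_empty eqxx.
Qed.

(** A generator of degree above [rho] would be a combination of elements of the
    module with coefficients in the irrelevant ideal, a relation whose
    coefficient at that generator has constant term 1. *)
Lemma koszul_regular_shifts r p rs cs (M : 'M[S]_(r, p)) rho :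
  homog_mx rs cs M -> min_ker M -> koszul_regular cs (img M) rho ->
  forall a, (rs a <= rho)%N.
Proof.
move=> hM kM regM a; rewrite leqNgt; apply/negP=> ra.
have [||b m|y yM yw] := @koszul_regular0 _ cs (img M) rho (row a M) _ regM.
- by exists 0; rewrite mul0mx.
- by exists (delta_mx 0 a); rewrite rowE.
- by rewrite mxE => /hM ->.
have [t tP] := fin_all_exists yM.
have /kM/(_ a) : (delta_mx 0 a - kosX t set0) *m M = 0.
  rewrite mulmxBl -koszul_mulmx -rowE -yw; apply/eqP; rewrite subr_eq0; apply/eqP.
  by apply: eq_koszul => B; rewrite tP.
rewrite !mxE mcoeffB koszul_coord_const subr0 !eqxx mcoeff1 eqxx.
by move/eqP; rewrite oner_eq0.
Qed.

End GradedModules.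

(** * Minimal homogeneous generators *)

Section MinimalGenerators.
Variables (n : nat) (K : fieldType).
Local Notation S := {mpoly K[n]}.
Implicit Types (m : 'X_{1..n}) (A B : {set 'I_n}) (r p : nat) (f g : S).

Definition mfilter (P : pred 'X_{1..n}) f : S :=
  \sum_(m : 'X_{1..n < msize f}) ((if P m then f@_m else 0) *: 'X_[m]).

Lemma mcoeff_mfilter P f m : (mfilter P f)@_m = if P m then f@_m else 0.
Proof.
case: (ltnP (mdeg m) (msize f)) => mf.
  exact: (mcoeff_mpoly (fun m => if P m then f@_m else 0) mf).
rewrite (memN_msupp_eq0 (msize_mdeg_ge mf)) if_same raddf_sum big1 // => k _ /=.
rewrite mcoeffZ mcoeffX; case: eqP => [km|]; last by rewrite mulr0.
by move: mf; rewrite -km leqNgt bmdeg.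
Qed.

Lemma mfilterM P P' f g : {in msupp g, forall m2 m1, P (m1 + m2)%MM = P' m1} ->
  mfilter P (f * g) = mfilter P' f * g.
Proof.
move=> PP; apply/mpolyP=> m; rewrite mcoeff_mfilter !mcoeffM.
case: ifP => Pm; [apply: eq_bigr|rewrite big1 //] => k /eqP mk;
  rewrite mcoeff_mfilter; case: (boolP (bmnm k.2 \in msupp g)) => [kg|/memN_msupp_eq0 ->];
  rewrite ?mulr0 //.
  by rewrite -(PP _ kg) -mk Pm.
by rewrite -(PP _ kg) -mk Pm mul0r.
Qed.

Lemma mfilter_sum (I : Type) (s : seq I) (Q : pred I) P (F : I -> S) :
  mfilter P (\sum_(i <- s | Q i) F i) = \sum_(i <- s | Q i) mfilter P (F i).
Proof.
apply/mpolyP=> m; rewrite mcoeff_mfilter !raddf_sum /=.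
under [RHS]eq_bigr => i _ do rewrite mcoeff_mfilter.
by case: ifP => // _; rewrite big1.
Qed.

Definition homog_part r (sh : 'I_r -> nat) j (v : 'rV[S]_r) : 'rV[S]_r :=
  \row_a mfilter (fun m => mdeg m + sh a == j)%N (v 0 a).

Lemma homog_part_homog r (sh : 'I_r -> nat) j v : homog_vec sh j (homog_part sh j v).
Proof.
by move=> a m; rewrite mxE mcoeff_msupp mcoeff_mfilter; case: ifP => [/eqP|]; rewrite ?eqxx.
Qed.

Lemma homog_part_id r (sh : 'I_r -> nat) j v : homog_vec sh j v -> homog_part sh j v = v.
Proof.
move=> hv; apply/rowP=> a; rewrite mxE; apply/mpolyP=> m; rewrite mcoeff_mfilter.
case: ifP => // mj; apply/esym/eqP; rewrite mcoeff_eq0.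
by apply: contraFN mj => /hv ->.
Qed.

Lemma homog_part_mulmx r p rs cs (M : 'M[S]_(r, p)) j v : homog_mx rs cs M ->
  homog_part cs j (v *m M) = homog_part rs j v *m M.
Proof.
move=> hM; apply/rowP=> b; rewrite !mxE mfilter_sum; apply: eq_bigr => a _.
rewrite mxE; apply: mfilterM => m2 /hM h m1.
by rewrite mdegD -addnA h.
Qed.

Lemma homog_part_sum r (I : Type) (s : seq I) (Q : pred I) (sh : 'I_r -> nat) j
    (F : I -> 'rV[S]_r) :
  homog_part sh j (\sum_(i <- s | Q i) F i) = \sum_(i <- s | Q i) homog_part sh j (F i).
Proof.
apply/rowP=> a; rewrite !mxE !summxE mfilter_sum.
by apply: eq_bigr => i _; rewrite mxE.
Qed.

Lemma homog_partZ r (sh : 'I_r -> nat) j c s (v : 'rV[S]_r) :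
  homog_part sh j.+1 ((c%:MP * 'X_s) *: v) = (c%:MP * 'X_s) *: homog_part sh j v.
Proof.
apply/rowP=> a; rewrite !mxE mulrC [RHS]mulrC; apply: mfilterM => m2 mm m1.
move: mm; rewrite mul_mpolyC => /msuppZ_le; rewrite msuppX inE => /eqP ->.
by rewrite mdegD mdeg1 addn1 addSn eqSS.
Qed.

Lemma sum_homog_part r (sh : 'I_r -> nat) (v : 'rV[S]_r) :
  exists N, v = \sum_(j < N) homog_part sh j v.
Proof.
exists (\max_a (msize (v 0%R a) + sh a))%N; apply/rowP=> a; rewrite summxE.
apply/mpolyP=> m; rewrite raddf_sum /=.
under eq_bigr => j _ do rewrite mxE mcoeff_mfilter.
case: (boolP (m \in msupp (v 0 a))) => [mv|/memN_msupp_eq0 ->]; last first.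
  by rewrite big1 // => j _; rewrite if_same.
have lt_N : (mdeg m + sh a < \max_a (msize (v 0%R a) + sh a))%N.
  apply: leq_trans (leq_bigmax (F := fun a => (msize (v 0%R a) + sh a)%N) a).
  by rewrite ltn_add2r msize_mdeg_lt.
rewrite (bigD1 (Ordinal lt_N)) //= eqxx big1 ?addr0 // => j.
by rewrite -val_eqE /= eq_sym => /negPf ->.
Qed.

Lemma not_forall_imply (T : Type) (P Q : T -> Prop) :
  ~ (forall v, P v -> Q v) -> exists2 v, P v & ~ Q v.
Proof.
move=> nPQ; apply: Classical_Prop.NNPP => nex; apply: nPQ => v Pv.
by apply: Classical_Prop.NNPP => nQ; apply: nex; exists v.
Qed.

Lemma finite_span (vT : vectType K) (P : vT -> Prop) :
  exists2 s : seq vT, (forall v, v \in s -> P v) & (forall v, P v -> v \in <<s>>%VS).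
Proof.
(* Induction on the codimension [k] of the span found so far. *)
suff: forall k (s : seq vT), (forall v, v \in s -> P v) ->
    (\dim {:vT} <= \dim <<s>> + k)%N ->
    exists2 s : seq vT, (forall v, v \in s -> P v) & (forall v, P v -> v \in <<s>>%VS).
  by move/(_ (\dim {:vT}) [::]); apply; rewrite ?leq_addl.
elim=> [|k IHk] s sP sk.
  exists s => // v _; rewrite (_ : <<s>>%VS = fullv) ?memvf //.
  by apply/eqP; rewrite eqEdim subvf -(addn0 (\dim <<s>>)).
have [spans|] := excluded_middle_informative (forall v, P v -> v \in <<s>>%VS).
  by exists s.
case/not_forall_imply => v Pv /negP vs.
apply: (IHk (v :: s)) => [u|].
  by rewrite inE => /orP[/eqP -> //|]; apply: sP.
apply: leq_trans sk _; rewrite -addSnnS leq_add2r ltn_neqAle.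
have ss : (<<s>> <= <<v :: s>>)%VS by rewrite span_cons addvSr.
rewrite dimvS // andbT; apply: contra vs => /eqP d.
have /eqP -> : <<s>>%VS == <<v :: s>>%VS by rewrite eqEdim ss d leqnn.
by rewrite memv_span ?mem_head.
Qed.

Lemma imgD r p (M : 'M[S]_(r, p)) u v : img M u -> img M v -> img M (u + v).
Proof. by move=> [a ->] [b ->]; exists (a + b); rewrite mulmxDl. Qed.

Lemma imgZ r p (M : 'M[S]_(r, p)) f v : img M v -> img M (f *: v).
Proof. by move=> [a ->]; exists (f *: a); rewrite scalemxAl. Qed.

Lemma img_sum r p (M : 'M[S]_(r, p)) (I : Type) (s : seq I) (P : pred I) F :
  (forall i, img M (F i)) -> img M (\sum_(i <- s | P i) F i).
Proof.
move=> MF; apply: big_ind => //; first by exists 0; rewrite mul0mx.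
exact: imgD.
Qed.

Definition submod r (Z : 'rV[S]_r -> Prop) :=
  [/\ Z 0, forall u v, Z u -> Z v -> Z (u + v) & forall f v, Z v -> Z (f *: v)].

Definition graded r (sh : 'I_r -> nat) (Z : 'rV[S]_r -> Prop) :=
  forall j v, Z v -> Z (homog_part sh j v).

Lemma submod_img r p (M : 'M[S]_(r, p)) Z : submod Z ->
  (forall a, Z (row a M)) -> forall z, img M z -> Z z.
Proof.
move=> [Z0 ZD ZZ] ZM _ [v ->]; rewrite mulmx_sum_row.
by apply: big_ind => // a _; apply: ZZ.
Qed.

(** A homogeneous vector of degree at most [rho] is encoded by its coefficients
    at monomials of degree at most [rho], a point of a finite-dimensional space. *)
Lemma low_degree_span r (sh : 'I_r -> nat) (Z : 'rV[S]_r -> Prop) rho :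
  exists r' (rs : 'I_r' -> nat) (N : 'M[S]_(r', r)),
  [/\ homog_mx rs sh N, forall a, (rs a <= rho)%N, forall a, Z (row a N)
    & forall j z, (j <= rho)%N -> Z z -> homog_vec sh j z -> img N z].
Proof.
pose V := {ffun 'I_r * 'X_{1..n < rho.+1} -> K^o}.
pose phi (v : 'rV[S]_r) : V := [ffun q => (v 0 q.1)@_(bmnm q.2)].
pose good v := Z v /\ exists2 j, (j <= rho)%N & homog_vec sh j v.
have [s sP span] := finite_span (fun u : V => exists2 v, phi v = u & good v).
pose t := in_tuple s.
have gP (a : 'I_(size s)) : exists vj : 'rV[S]_r * nat,
    [/\ phi vj.1 = tnth t a, Z vj.1, (vj.2 <= rho)%N & homog_vec sh vj.2 vj.1].
  by have [v ? [? [j ? ?]]] := sP _ (mem_tnth a t); exists (v, j).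
have [g {}gP] := fin_all_exists gP.
pose N := \matrix_(a < size s) (g a).1.
have rowN a : row a N = (g a).1 by apply/rowP=> b; rewrite !mxE.
exists (size s), (fun a => (g a).2), N; split=> [a b m|a|a|j z jr Zz hz].
- by rewrite mxE; case: (gP a) => _ _ _; apply.
- by case: (gP a).
- by rewrite rowN; case: (gP a).
have /coord_span zE : phi z \in <<t>>%VS by apply: span; exists z; last by split; last by exists j.
exists (\row_a (coord t a (phi z))%:MP); apply/rowP=> b; rewrite !mxE; apply/mpolyP=> m.
rewrite raddf_sum /=.
have -> : \sum_a ((\row_a (coord t a (phi z))%:MP) 0 a * N a b)@_m =
          \sum_a coord t a (phi z) * ((g a).1 0 b)@_m.
  by apply: eq_bigr => a _; rewrite !mxE mcoeffCM.
case: (ltnP (mdeg m) rho.+1) => mr.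
  have /ffunP/(_ (b, BMultinom mr)) := zE; rewrite ffunE /= => ->.
  rewrite sum_ffunE; apply: eq_bigr => a _.
  have -> : t`_a = phi (g a).1 by case: (gP a) => ->; rewrite (tnth_nth 0).
  by rewrite !ffunE /=.
have hi (v : 'rV[S]_r) i : (i <= rho)%N -> homog_vec sh i v -> (v 0 b)@_m = 0.
  move=> ir hv; apply/eqP; rewrite mcoeff_eq0; apply: contraL ir => /hv <-.
  by rewrite -ltnNge (leq_trans mr) ?leq_addr.
rewrite (hi z j) // big1 // => a _; have [_ _ ga hga] := gP a.
by rewrite (hi _ _ ga hga) mulr0.
Qed.

(** Elements of degree above [rho] are combinations of elements of smaller degree
    by [koszul_regular0], so the low degrees generate everything. *)
Lemma koszul_regular_generated r (sh : 'I_r -> nat) Z rho p (N : 'M[S]_(p, r)) :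
  submod Z -> graded sh Z -> koszul_regular sh Z rho ->
  (forall j z, (j <= rho)%N -> Z z -> homog_vec sh j z -> img N z) ->
  forall z, Z z -> img N z.
Proof.
move=> [Z0 ZD ZZ] Zgr regZ low.
have hom j z : Z z -> homog_vec sh j z -> img N z.
  elim: j z => [|j IHj] z Zz hz; first exact: low hz.
  case: (leqP j.+1 rho) => jr; first exact: low hz.
  have [|y yZ yz] := koszul_regular0 Z0 regZ Zz; first by move=> a m /hz ->.
  rewrite -(homog_part_id hz) -yz homog_part_sum.
  apply: img_sum => s; rewrite kos_signC homog_partZ; apply: imgZ.
  by apply: IHj; [apply/Zgr/yZ | apply: homog_part_homog].
move=> z Zz; have [M ->] := sum_homog_part sh z; apply: img_sum => j.
by apply: (hom j) (@homog_part_homog _ sh j z); apply: Zgr.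
Qed.

(** A relation with a nonzero constant term at [a] has a homogeneous component in
    which that constant is the whole coefficient; it expresses the row [a]
    through the others. *)
Lemma drop_generator r p rs (sh : 'I_r -> nat) (N : 'M[S]_(p.+1, r)) (u : 'rV[S]_p.+1) a :
  homog_mx rs sh N -> u *m N = 0 -> (u 0 a)@_0%MM != 0 ->
  forall z, img N z -> img (row' a N) z.
Proof.
move=> hN uN ua z [v ->].
have := homog_part_mulmx (rs a) u hN; rewrite uN.
have -> : homog_part sh (rs a) 0 = 0 :> 'rV[S]_r.
  by apply/rowP=> b; rewrite !mxE; apply/mpolyP=> m; rewrite mcoeff_mfilter mcoeff0 if_same.
set u' := homog_part rs (rs a) u => u'N.
have u'a : u' 0 a = ((u 0 a)@_0%MM)%:MP.
  rewrite !mxE; apply/mpolyP=> m; rewrite mcoeff_mfilter mcoeffC -[X in (_ == X)%N]add0n.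
  rewrite eqn_add2r mdeg_eq0; case: eqP => [->|_]; by rewrite ?mulr1 ?mulr0.
move: u' u'N u'a => u' u'N u'a.
pose w := v - (v 0 a * ((u 0 a)@_0%MM)^-1%:MP) *: u'.
have wa : w 0 a = 0.
  by rewrite !mxE u'a -mulrA -mpolyCM mulVf // mpolyC1 mulr1 subrr.
have wN : w *m N = v *m N by rewrite mulmxBl -scalemxAl -u'N scaler0 subr0.
exists (col' a w); rewrite -wN; apply/rowP=> b; rewrite !mxE.
rewrite (bigD1_ord a) //= wa mul0r add0r; apply: eq_bigr => i _.
by rewrite !mxE.
Qed.

(** Graded Nakayama: redundant generators are dropped from a finite homogeneous
    system until no relation has a constant term. *)
Lemma minimal_generators r (sh : 'I_r -> nat) Z rho :
  submod Z -> graded sh Z -> koszul_regular sh Z rho ->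
  exists p (rs : 'I_p -> nat) (N : 'M[S]_(p, r)),
  [/\ homog_mx rs sh N, forall a, (rs a <= rho)%N,
      forall z, Z z <-> img N z & min_ker N].
Proof.
move=> Zsub Zgr regZ.
have [p [rs [N [hN rsN ZN low]]]] := low_degree_span sh Z rho.
have genN : forall z, Z z -> img N z.
  by apply: koszul_regular_generated Zsub Zgr regZ _ => j z; apply: low.
elim: p rs N hN rsN ZN genN {low} => [|p IHp] rs N hN rsN ZN genN.
  exists 0%N, rs, N; split=> // [z|v _ []//].
  by split; [apply: genN | apply: submod_img].
have [minN|] := excluded_middle_informative (min_ker N).
  exists p.+1, rs, N; split=> // z.
  by split; [apply: genN | apply: submod_img].
case/not_forall_imply => u uN nu.
have [a /eqP ua] : exists a, (u 0 a)@_0%MM <> 0.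
  by apply: Classical_Prop.NNPP => nex; apply: nu => a; apply: Classical_Prop.NNPP => ua;
     apply: nex; exists a.
apply: (IHp (rs \o lift a) (row' a N)) => [i b m|i|i|z /genN].
- by rewrite mxE => /hN.
- exact: rsN.
- by rewrite (_ : row i _ = row (lift a i) N) //; apply/rowP=> b; rewrite !mxE.
- exact: drop_generator hN uN ua z.
Qed.

End MinimalGenerators.

(** * Minimal graded free resolutions *)

Section Resolutions.
Variables (n : nat) (K : fieldType).
Local Notation S := {mpoly K[n]}.
Implicit Types (m : 'X_{1..n}) (I : S -> Prop) (rho : nat).

Lemma submod_ker r p (M : 'M[S]_(r, p)) : submod (fun v => v *m M = 0).
Proof.
split=> [|u v uM vM|f v vM]; first exact: mul0mx.
  by rewrite mulmxDl uM vM addr0.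
by rewrite -scalemxAl vM scaler0.
Qed.

Lemma graded_ker r p rs cs (M : 'M[S]_(r, p)) : homog_mx rs cs M ->
  graded rs (fun v => v *m M = 0).
Proof.
move=> hM j v vM; rewrite -(homog_part_mulmx _ _ hM) vM.
by apply/rowP=> b; rewrite !mxE; apply/mpolyP=> m; rewrite mcoeff_mfilter mcoeff0 if_same.
Qed.

Lemma mul_const0 r p (w : 'rV[S]_r) (M : 'M[S]_(r, p)) :
  (forall a b, (M a b)@_0%MM = 0) -> forall b, ((w *m M) 0 b)@_0%MM = 0.
Proof.
move=> M0 b; rewrite mxE raddf_sum big1 // => a _ /=.
by rewrite rmorphM /= M0 mulr0.
Qed.

Record syzygies (r : nat) := Syzygies {
  syz_rank : nat;
  syz_shift : 'I_syz_rank -> nat;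
  syz_mx : 'M[S]_(syz_rank, r) }.

(** A step of the construction of a resolution. Keeping the target rank as a
    field makes the source of one stage definitionally the target of the next,
    so that consecutive matrices compose without casts. *)
Record stage := Stage {
  st_target : nat;
  st_target_shift : 'I_st_target -> nat;
  st_map : syzygies st_target }.

Definition good_stage rho (st : stage) :=
  let N := st_map st in
  [/\ homog_mx (@syz_shift _ N) (@st_target_shift st) (syz_mx N),
      forall a, (syz_shift (s := N) a <= rho)%N,
      koszul_regular (@st_target_shift st) (img (syz_mx N)) rho
    & min_ker (syz_mx N)].

Definition next_stage (st : stage) (N : syzygies (syz_rank (st_map st))) : stage :=
  Stage (@syz_shift _ (st_map st)) N.

Definition good_next rho (st : stage) (N : syzygies (syz_rank (st_map st))) :=
  good_stage rho.+1 (next_stage N) /\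
  forall z, z *m syz_mx (st_map st) = 0 <-> img (syz_mx N) z.

Lemma good_next_exists rho st : good_stage rho st -> exists N, @good_next rho st N.
Proof.
case=> hM rsM regM minM.
have regK := koszul_regular_ker hM rsM regM.
have [p [rs [N [hN rsN ZN minN]]]] :=
  minimal_generators (submod_ker _) (graded_ker hM) regK.
exists (Syzygies rs N); split=> //; split=> //.
exact: eq_koszul_regular regK.
Qed.

Definition choose_next rho st : syzygies (syz_rank (st_map st)) :=
  epsilon (inhabits (Syzygies (fun=> 0%N) (0 : 'M[S]_(0, _)))) (@good_next rho st).

Fixpoint stages rho (st : stage) i : stage :=
  if i is i'.+1 then next_stage (choose_next (rho + i') (stages rho st i')) else st.

Lemma good_stages rho st i : good_stage rho st ->
  good_stage (rho + i) (stages rho st i) /\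
  good_next (rho + i) (choose_next (rho + i) (stages rho st i)).
Proof.
move=> st0.
have next j : good_stage (rho + j) (stages rho st j) ->
    good_next (rho + j) (choose_next (rho + j) (stages rho st j)).
  by move=> /good_next_exists; apply: epsilon_spec.
have stg : good_stage (rho + i) (stages rho st i).
  by elim: i => [|i /next[h _]]; rewrite ?addn0 // addnS.
by split; last exact: next.
Qed.

Definition row_ideal I (v : 'rV[S]_1) := I (v 0 0).

(** Minimal generators of the successive kernels form the resolution; each kernel
    is finitely generated because it inherits regularity from the one before. *)
Theorem minimal_resolution_exists I rho :
  submod (row_ideal I) -> graded (fun=> 0%N) (row_ideal I) ->
  koszul_regular (fun=> 0%N) (row_ideal I) rho ->
  exists F, minimal_graded_free_resolution F I.
Proof.
move=> Isub Igr regI.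
have [p [rs [N [hN rsN IN minN]]]] := minimal_generators Isub Igr regI.
pose st0 := Stage (fun _ : 'I_1 => 0%N) (Syzygies rs N).
have good0 : good_stage rho st0 by split=> //; apply: eq_koszul_regular regI.
pose st := stages rho st0.
pose F := @GradedFreeComplex K n (fun i => syz_rank (st_map (st i)))
  (fun i => @syz_shift _ (st_map (st i)))
  (fun i => syz_mx (choose_next (rho + i) (st i))) N.
have good i := good_stages i good0.
exists F; split; first split.
- move=> a; apply/dhomogP => m /hN; by rewrite addn0.
- by move=> i a b; case: (good i) => _ [[+ _ _ _] _]; apply.
- split=> [f|v|i v].
  + have -> : I f <-> row_ideal I f%:M by rewrite /row_ideal mxE.
    by rewrite IN; split=> -[v h]; exists v.
  + by case: (good 0%N) => _ [].
  by case: (good i.+1) => _ [].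
move=> i a b; have [[_ _ _ minM] [_ exM]] := good i.
have /minM/(_ b) : row a (gfc_diff F i) *m syz_mx (st_map (st i)) = 0.
  by apply/exM; exists (delta_mx 0 a); rewrite rowE.
by rewrite mxE.
Qed.

(** Regularity bounds the degrees of the generators and passes to the kernel,
    which is the next image by exactness. *)
Lemma resolution_shifts F I rho : minimal_graded_free_resolution F I ->
  koszul_regular (fun=> 0%N) (row_ideal I) rho ->
  forall i (a : 'I_(gfc_rank F i)), (gfc_shift a <= rho + i)%N.
Proof.
move=> [[haug hdiff] [ex0 ex1 ex2] minF] regI.
have hA : homog_mx (@gfc_shift _ _ F 0) (fun _ : 'I_1 => 0%N) (gfc_aug F).
  by move=> a b m; rewrite ord1 addn0 => /(dhomog_mf (haug a)).
have regA : koszul_regular (fun _ : 'I_1 => 0%N) (img (gfc_aug F)) rho.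
  apply: eq_koszul_regular regI => v; rewrite /row_ideal ex0.
  have -> : (v 0 0)%:M = v by apply/rowP=> b; rewrite !ord1 mxE eqxx mulr1n.
  by split=> -[w h]; exists w.
have minA : min_ker (gfc_aug F).
  by move=> v /ex1[w ->]; apply: mul_const0; apply: minF.
have minD i : min_ker (gfc_diff F i).
  by move=> v /ex2[w ->]; apply: mul_const0; apply: minF.
suff h i : (forall a : 'I_(gfc_rank F i), (gfc_shift a <= rho + i)%N) /\
    koszul_regular (@gfc_shift _ _ F i) (img (gfc_diff F i)) (rho + i).+1.
  by move=> i; case: (h i).
elim: i => [|i [_ IHi]].
  have sh0 := koszul_regular_shifts hA minA regA.
  rewrite addn0; split=> //.
  by apply: eq_koszul_regular (koszul_regular_ker hA sh0 regA).
have shS := koszul_regular_shifts (hdiff i) (minD i) IHi.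
rewrite addnS; split=> //.
by apply: eq_koszul_regular (koszul_regular_ker (hdiff i) shS IHi).
Qed.

(** The equation expressing [mu] through the generators must contain [mu] itself
    as a monomial of one of them, because [mu] is minimal in the ideal. *)
Lemma resolution_generator F I (P : pred 'X_{1..n}) mu :
  minimal_graded_free_resolution F I ->
  (forall f, I f <-> supported P f) -> min_monomial_generator I mu ->
  exists a : 'I_(gfc_rank F 0), gfc_shift a = mdeg mu.
Proof.
move=> [[haug _] [ex0 _ _] _] IP [Imu minmu].
have /ex0[v vmu] := Imu.
have [a] : exists a, (v 0 a * gfc_aug F a 0)@_mu != 0.
  apply/existsP; apply: contraT; rewrite negb_exists => /forallP h.
  have /matrixP/(_ 0 0)/(congr1 (mcoeff mu)) := vmu.
  rewrite !mxE mcoeffX eqxx raddf_sum big1 => [/eqP|a _].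
    by rewrite eq_sym oner_eq0.
  by apply/eqP; have := h a; rewrite negbK.
rewrite -mcoeff_msupp => /msuppM_le/allpairsP[[m1 m2] /= [_ m2a muE]].
exists a; rewrite -(dhomog_mf (haug a) m2a).
congr mdeg; apply: minmu; last by rewrite muE lem_addl.
apply/IP => m; rewrite msuppX inE => /eqP ->.
have /IP : I (gfc_aug F a 0).
  apply/ex0; exists (delta_mx 0 a); apply/rowP=> b.
  by rewrite -rowE !mxE ord1 eqxx mulr1n.
exact.
Qed.

Lemma maximumE (P : int -> Prop) v :
  P v -> (forall x, P x -> x <= v) -> maximum P = v.
Proof.
move=> Pv maxv.
have [|Pm maxm] := epsilon_spec (inhabits 0) (fun b => P b /\ forall x, P x -> x <= b).
  by exists v.
by apply/le_anti; rewrite maxv //= maxm.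
Qed.

Theorem regularityE I (P : pred 'X_{1..n}) rho mu :
  (forall f, I f <-> supported P f) ->
  koszul_regular (fun=> 0%N) (row_ideal I) rho ->
  (forall m1 m2, P m2 -> P (m1 + m2)%MM) ->
  min_monomial_generator I mu -> mdeg mu = rho ->
  regularity I = rho%:Z.
Proof.
move=> IP regI Pup Imu murho.
have exF : exists F, minimal_graded_free_resolution F I.
  apply: minimal_resolution_exists regI.
    split=> [|u v /IP uP /IP vP|f v /IP vP]; apply/IP; rewrite mxE.
    - by move=> m; rewrite msupp0.
    - by move=> m /msuppD_le; rewrite mem_cat => /orP[/uP|/vP].
    - by apply: (supportedM (P := predT)) vP => // m1 m2 _; apply: Pup.
  move=> j v /IP vP; apply/IP => m; rewrite mxE mcoeff_msupp mcoeff_mfilter.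
  by case: ifP => _; rewrite ?eqxx // -mcoeff_msupp => /vP.
have bettiP i j : exists F, minimal_graded_free_resolution F I /\
    betti I i j = #|[set a : 'I_(gfc_rank F i) | gfc_shift a == j]|.
  apply: (epsilon_spec (inhabits 0%N) (fun b => exists F, minimal_graded_free_resolution F I /\
    b = #|[set a : 'I_(gfc_rank F i) | gfc_shift a == j]|)).
  by have [F hF] := exF; exists #|[set a : 'I_(gfc_rank F i) | gfc_shift a == j]|, F.
apply: maximumE => [|x [i [j [b0 ->]]]].
  exists 0%N, rho; split; last by rewrite subr0.
  have [F [hF ->]] := bettiP 0%N rho.
  have [a ash] := resolution_generator hF IP Imu.
  by move/eqP; rewrite cards_eq0 => /eqP/setP/(_ a); rewrite !inE ash murho eqxx.
have [F [hF bE]] := bettiP i j.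
move/eqP: b0; rewrite bE cards_eq0 => /set0Pn[a]; rewrite inE => /eqP <-.
by have := resolution_shifts hF regI a; lia.
Qed.

End Resolutions.

(** * Independent sets of 1-well-covered graphs *)

Section WellCovered.
Variables (T : finType) (e : rel T).
Hypotheses (e_sym : ssrbool.symmetric e) (e_irr : irreflexive e).
Implicit Types (x y u v : T) (A B C W : {set T}).

Lemma independentP A :
  reflect (forall x y, x \in A -> y \in A -> ~~ e x y) (independent e A).
Proof.
apply: (iffP forall_inP) => [h x y xA yA|h x xA]; first exact: (forall_inP (h x xA)).
by apply/forall_inP=> y yA; apply: h.
Qed.

Lemma sub_independent A B : A \subset B -> independent e B -> independent e A.
Proof.
move=> /subsetP AB /independentP iB.
by apply/independentP=> x y /AB xB /AB; apply: iB.
Qed.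

Lemma vertex_coverC W A : A \subset W ->
  vertex_cover e W (W :\: A) = independent e A.
Proof.
move=> /subsetP AW; rewrite /vertex_cover subsetDl /=.
apply/forall_inP/independentP => [h x y xA yA|h x xW].
  have /forall_inP/(_ y (AW _ yA)) := h x (AW _ xA).
  by rewrite !inE xA yA /= implybF.
apply/forall_inP=> y yW; rewrite !inE xW yW !andbT -negb_and.
by apply/implyP; apply: contraL => /andP[xA yA]; apply: h.
Qed.

Lemma maximal_independent_ext W A : A \subset W -> independent e A ->
  exists B, [/\ A \subset B, B \subset W, independent e B
              & min_vertex_cover e W (W :\: B)].
Proof.
move=> AW iA.
have [|B /maxsetP[/andP[BW iB] maxB] AB] :=
    @maxset_exists _ (fun B => (B \subset W) && independent e B) A.
  by rewrite AW.
exists B; split=> //; apply/minsetP; split; first by rewrite vertex_coverC.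
move=> C /[dup] vC /andP[CW _] CB.
have CE : W :\: (W :\: C) = C by rewrite setDDr setDv set0U (setIidPr CW).
have WC : B \subset W :\: C.
  rewrite subsetD BW -setI_eq0; apply/eqP/setP=> x; rewrite !inE.
  apply/negP=> /andP[xB xC]; have := subsetP CB _ xC; by rewrite !inE xB.
rewrite -CE (maxB (W :\: C)) // subsetDl /=.
by rewrite -(vertex_coverC (subsetDl W C)) CE.
Qed.

Lemma leq_indep_number W A : A \subset W -> independent e A ->
  (#|A| <= indep_number e W)%N.
Proof.
by move=> AW iA; apply: (leq_bigmax_cond (F := fun B : {set T} => #|B|)); rewrite AW.
Qed.

(** The complements of maximal independent sets are the minimal covers, so all
    maximal independent sets have the same size. *)
Lemma well_covered_ext W A : well_covered e W -> A \subset W -> independent e A ->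
  exists B, [/\ A \subset B, B \subset W, independent e B & #|B| = indep_number e W].
Proof.
move=> wcW AW iA.
have [B [AB BW iB mB]] := maximal_independent_ext AW iA.
exists B; split=> //; apply/eqP; rewrite eqn_leq leq_indep_number //=.
apply/bigmax_leqP=> D /andP[DW iD].
have [B' [DB' BW' _ mB']] := maximal_independent_ext DW iD.
apply: leq_trans (subset_leq_card DB') _.
have := wcW _ _ mB mB'; rewrite !cardsD (setIidPr BW) (setIidPr BW').
have := subset_leq_card BW; have := subset_leq_card BW'; lia.
Qed.

Hypothesis wc1 : one_well_covered e.
Local Notation alpha := (indep_number e [set: T]).

(** Deleting [x] leaves a well-covered graph with the same independence number,
    so [B :\ x] extends there by a vertex [y]; as [B] is maximum, [y] cannot be
    added to [B] and must be adjacent to [x]. *)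
Lemma independent_exchange B x : independent e B -> #|B| = alpha -> x \in B ->
  exists y, [/\ y \notin B, e x y & independent e (y |: B :\ x)].
Proof.
move=> iB cB xB; have [wcx ax] := wc1.2 x.
have BxW : B :\ x \subset ~: [set x] by apply/subsetP=> y; rewrite !inE => /andP[].
have [D [BD DW iD cD]] :=
  well_covered_ext wcx BxW (sub_independent (subsetDl _ _) iB).
have /subsetPn[y yD yB] : ~~ (D \subset B :\ x).
  apply: contraL (leqnn #|D|) => /subset_leq_card; rewrite cD ax -cB (cardsD1 x B) xB.
  by rewrite add1n => h; rewrite -ltnNge ltnS.
have yx : y != x by have := subsetP DW _ yD; rewrite !inE.
have {}yB : y \notin B by move: yB; rewrite !inE yx.
have iy : independent e (y |: B :\ x).
  by apply: sub_independent iD; rewrite subUset sub1set yD.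
exists y; split=> //; apply: contraT => nxy.
have : independent e (y |: B).
  apply/independentP=> u v; rewrite !inE => /orP[/eqP->|uB] /orP[/eqP->|vB].
  - by rewrite e_irr.
  - case: (v =P x) => [->|/eqP vx]; first by rewrite e_sym.
    by apply: (independentP _ iy); rewrite !inE ?eqxx // vx vB orbT.
  - case: (u =P x) => [->//|/eqP ux].
    by apply: (independentP _ iy); rewrite !inE ?eqxx // ux uB orbT.
  - exact: (independentP _ iB).
move/(leq_indep_number (subsetT _)); rewrite cardsU1 yB cB.
by rewrite ltnn.
Qed.

(** [B] and [D] are maximum independent sets containing [A] with the least
    possible intersection. A common vertex outside [A] could be exchanged in [D]
    for one of its neighbours, which is not in [B]; hence they meet exactly in
    [A], and their union is disjoint from the neighbourhood of [A]. *)
Lemma open_nbhd_bound A : independent e A ->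
  (#|open_nbhd e A| + 2 * alpha <= #|T| + #|A|)%N.
Proof.
move=> iA.
have [B [AB _ iB cB]] := well_covered_ext wc1.1 (subsetT A) iA.
pose P (D : {set T}) := [&& A \subset D, independent e D & #|D| == alpha].
have PB : P B by rewrite /P AB iB cB eqxx.
case: (arg_minnP (fun D : {set T} => #|D :&: B|) PB) => D /and3P[AD iD /eqP cD] minD.
have DB : D :&: B \subset A.
  apply/subsetP=> x; rewrite inE => /andP[xD xB]; apply: contraT => xA.
  have [y [yD xy iy]] := independent_exchange iD cD xD.
  have yB : y \notin B.
    by apply: contraL xy => yB; apply: (independentP _ iB).
  have := minD (y |: D :\ x); rewrite /P iy cardsU1 !inE negb_and yD orbT.
  have -> : (1 + #|D :\ x| = alpha)%N by rewrite -cD (cardsD1 x D) xD.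
  rewrite eqxx subsetU /= => [/(_ isT)|]; last first.
    by rewrite subsetD1 AD xA orbT.
  rewrite leqNgt => /negP[]; apply: proper_card; apply/properP; split.
    apply/subsetP=> z; rewrite !inE => /andP[/orP[/eqP->|/andP[_ ->]] //].
    by rewrite (negPf yB).
  exists x; rewrite !inE ?xD ?xB // eqxx /= orbF andbT.
  by apply: contraNneq yD => <-.
have NU : open_nbhd e A \subset ~: (D :|: B).
  apply/subsetP=> y; rewrite !inE => /exists_inP[x xA xy].
  rewrite negb_or; apply/andP; split; apply: contraL xy => yD.
    exact: (independentP _ iD _ _ (subsetP AD _ xA)).
  exact: (independentP _ iB _ _ (subsetP AB _ xA)).
have := subset_leq_card NU; have := subset_leq_card DB.
have := cardsUI D B; have := cardsC (D :|: B); rewrite cD cB; lia.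
Qed.

Lemma card_min_vertex_cover C : min_vertex_cover e [set: T] C ->
  (#|C| + alpha = #|T|)%N.
Proof.
move=> mC.
have i0 : independent e set0 by apply/independentP=> x y; rewrite inE.
have [B [_ _ _ mB]] := maximal_independent_ext (sub0set [set: T]) i0.
have [D [_ _ iD cD]] := well_covered_ext wc1.1 (sub0set _) i0.
have [B' [DB' _ iB' mB']] := maximal_independent_ext (subsetT D) iD.
have := leq_indep_number (subsetT _) iB'; have := subset_leq_card DB'.
have := wc1.1 _ _ mC mB'; rewrite setTD; have := cardsC B'; rewrite cD; lia.
Qed.

Lemma sum_ltn_minn m c : (\sum_(t < m) (t < c) = minn m c)%N.
Proof.
by elim: m => [|m IHm]; rewrite ?big_ord0 ?big_ord_recr /= ?IHm; lia.
Qed.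

(** Pair the levels [t] and [2m - 1 - t], for [t < m]. The set [A] where
    [c <= t] is independent, and each vertex of the level set [c > 2m - 1 - t]
    has a tight neighbour, which lies in [A]; so the two level sets contribute
    at most [(#|T| - #|A|) + #|open_nbhd e A|]. *)
Lemma tight_cover_bound m (c : T -> nat) :
  (forall x y, e x y -> (2 * m <= c x + c y)%N) ->
  (forall v, (m < c v)%N -> exists2 u, e v u & (c u + c v = 2 * m)%N) ->
  (\sum_v c v <= 2 * m * (#|T| - alpha))%N.
Proof.
move=> cov tight.
have c2m v : (c v <= 2 * m)%N.
  by case: (ltnP m (c v)) => [/tight[u _]|]; lia.
have cE v : c v = (\sum_(t < m) ((t < c v) + (2 * m - t.+1 < c v)))%N.
  rewrite big_split /= sum_ltn_minn.
  rewrite (reindex_inj rev_ord_inj) /= (eq_bigr (fun t : 'I_m => (t < c v - m : nat))).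
    by rewrite sum_ltn_minn; have := c2m v; lia.
  by move=> t _; have := ltn_ord t; lia.
rewrite (eq_bigr _ (fun v _ => cE v)) exchange_big /=.
apply: (leq_trans (n := (\sum_(t < m) 2 * (#|T| - alpha))%N)); last first.
  by rewrite sum_nat_const card_ord mulnCA mulnA.
apply: leq_sum => t _; rewrite big_split /=.
pose A := [set v | (c v <= t)%N].
have iA : independent e A.
  apply/independentP=> x y; rewrite !inE => xt yt; apply/negP=> /cov.
  by have := ltn_ord t; lia.
have -> : (\sum_v (t < c v) = #|~: A|)%N.
  rewrite -sum1_card [RHS]big_mkcond; apply: eq_bigr => v _.
  by rewrite !inE -ltnNge; case: ltnP.
have : (\sum_v (2 * m - t.+1 < c v) <= #|open_nbhd e A|)%N.
  rewrite -sum1_card [X in (_ <= X)%N]big_mkcond; apply: leq_sum => v _.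
  case: ltnP => // tv; rewrite ifT // inE.
  have [|u vu cu] := tight v; first by have := ltn_ord t; lia.
  by apply/exists_inP; exists u; rewrite 1?e_sym // inE; have := ltn_ord t; lia.
move=> h; apply: leq_trans (leq_add (leqnn _) h) _.
have := open_nbhd_bound iA; have := cardsC A.
by move: #|A| #|~: A| #|T| #|open_nbhd e A| alpha => a a' t' b al; lia.
Qed.

Lemma gamma_value_le A : independent e A ->
  gamma_value e A <= (#|T| - alpha)%:R.
Proof.
move=> /open_nbhd_bound h; rewrite /gamma_value ler_pdivrMr ?ltr0n //.
rewrite lerBlDr -natrM -!natrD ler_nat.
by have := leq_indep_number (subsetT set0); have := cardsT T; lia.
Qed.

Lemma gamma_witness :
  exists2 A, gamma_set e A && gamma0_set e A &
    gamma_value e A = (#|T| - alpha)%:R.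
Proof.
have i0 : independent e set0 by apply/independentP=> x y; rewrite inE.
have [A [_ _ iA cA]] := well_covered_ext wc1.1 (sub0set _) i0.
have NA : open_nbhd e A = ~: A.
  apply/setP=> y; rewrite !inE; apply/exists_inP/idP => [[x xA xy]|yA].
    by apply: contraL xy => yA; apply: (independentP _ iA).
  apply/exists_inP; apply: contraT => /exists_inPn noe.
  have : independent e (y |: A).
    apply/independentP=> u v; rewrite !inE => /orP[/eqP->|uB] /orP[/eqP->|vB].
    - by rewrite e_irr.
    - by rewrite e_sym noe.
    - by rewrite noe.
    - exact: (independentP _ iA).
  by move/(leq_indep_number (subsetT _)); rewrite cardsU1 yA cA ltnn.
have no C : C \in components e (~: closed_nbhd e A) = false.
  rewrite /closed_nbhd NA setUC setUCr setCT /components /equivalence_partition.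
  by apply/negP=> /imsetP[x]; rewrite inE.
exists A.
  by rewrite /gamma_set /gamma0_set iA /=; apply/andP; split;
     apply/forall_inP=> C; rewrite no.
rewrite /gamma_value NA; have := cardsC A; rewrite cA => <-.
by rewrite addKn !natrD; field.
Qed.

Lemma gammaE : gamma e = (#|T| - alpha)%:R.
Proof.
apply/eqP; rewrite eq_le; apply/andP; split.
  apply: bigmax_le; first by rewrite ler0n.
  by move=> A /andP[iA _]; apply: gamma_value_le.
have [A /andP[gA _] <-] := gamma_witness.
exact: le_bigmax_cond.
Qed.

Lemma gamma0E : gamma0 e = (#|T| - alpha)%:R.
Proof.
apply/eqP; rewrite eq_le; apply/andP; split.
  apply: bigmax_le; first by rewrite ler0n.
  by move=> A /andP[iA _]; apply: gamma_value_le.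
have [A /andP[_ gA] <-] := gamma_witness.
exact: le_bigmax_cond.
Qed.

End WellCovered.

(** * Symbolic powers of cover ideals *)

Section SymbolicPowers.
Variables (n : nat) (K : fieldType) (e : rel 'I_n).
Hypotheses (e_sym : ssrbool.symmetric e) (e_irr : irreflexive e).
Local Notation S := {mpoly K[n]}.
Implicit Types (m b : 'X_{1..n}) (A B X : {set 'I_n}) (f g : S).

(** Membership in an ideal generated by monomials can be tested on each monomial
    of the polynomial separately. *)
Lemma ideal_gen_monomials (G : S -> Prop) f :
  {in msupp f, forall m, exists u v : S, G v /\ 'X_[m] = u * v} -> ideal_gen G f.
Proof.
move=> Gf; pose s := msupp f.
have h (t : 'I_(size s)) : exists uv : S * S,
    G uv.2 /\ 'X_[tnth (in_tuple s) t] = uv.1 * uv.2.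
  by have [u [v uv]] := Gf _ (mem_tnth t (in_tuple s)); exists (u, v).
have [uv uvP] := fin_all_exists h.
exists (size s), (fun t => f@_(tnth (in_tuple s) t) *: (uv t).1), (fun t => (uv t).2).
split=> [t|]; first by case: (uvP t).
rewrite {1}[f]mpolyE big_tnth; apply: eq_bigr => t _.
by rewrite -scalerAl; case: (uvP t) => _ <-.
Qed.

Definition edge_degree (i j : 'I_n) k m := (k <= m i + m j)%N.

Lemma edge_primeP (i j : 'I_n) f :
  edge_prime i j f <-> supported (edge_degree i j 1) f.
Proof.
split=> [[r [a [g [gP ->]]]]|Pf].
  apply: supported_sum => t.
  apply: (supportedM (P := predT) (Q := edge_degree i j 1)) => //; last first.
    move=> m; rewrite /edge_degree; case: (gP t) => ->; rewrite msuppX inE => /eqP ->.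
      by rewrite !mnm1E eqxx.
    by rewrite !mnm1E eqxx; case: eqP.
  by move=> m1 m2 _; rewrite /edge_degree !mnmDE; lia.
apply: ideal_gen_monomials => m /Pf; rewrite /edge_degree => mij.
have XE v : (0 < m v)%N -> 'X_[m] = 'X_[m - U_(v)] * 'X_v :> S.
  by move=> mv; rewrite -mpolyXD submK // lep1mP -lt0n.
have [mi|mj] : (0 < m i)%N \/ (0 < m j)%N by lia.
- by exists 'X_[m - U_(i)], 'X_i; split; [left | apply: XE].
- by exists 'X_[m - U_(j)], 'X_j; split; [right | apply: XE].
Qed.

(** A product of [k] variables, each one of the two ends of the edge, divides
    every monomial of degree at least [k] in these two variables. *)
Lemma edge_prime_powerP (i j : 'I_n) k f : i != j ->
  ideal_power (edge_prime i j) k f <-> supported (edge_degree i j k) f.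
Proof.
move=> ij; split=> [[r [a [g [gP ->]]]]|Pf].
  apply: supported_sum => t.
  apply: (supportedM (P := predT) (Q := edge_degree i j k)) => //; last first.
    case: (gP t) => h [hP ->] {a g gP t r f}.
    elim: k h hP => [|k IHk] h hP; first by move=> m _; rewrite /edge_degree.
    rewrite big_ord_recl.
    apply: (supportedM (P := edge_degree i j 1) (Q := edge_degree i j k)).
    - by move=> m1 m2; rewrite /edge_degree !mnmDE; lia.
    - exact/edge_primeP/hP.
    - by apply: IHk => t; apply: hP.
  by move=> m1 m2 _; rewrite /edge_degree !mnmDE; lia.
apply: ideal_gen_monomials => m /Pf; rewrite /edge_degree => mij.
(* As many factors ['X_i] as [m] allows, then ['X_j]. *)
pose a := minn k (m i); pose u := (U_(i) *+ a + U_(j) *+ (k - a))%MM.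
have um : (u <= m)%MM.
  apply/mnm_lepP=> v; rewrite mnmDE !mulmnE !mnm1E.
  case: (i =P v) => [<-|_]; first by rewrite eq_sym (negPf ij); lia.
  by case: (j =P v) => [<-|_]; lia.
exists 'X_[m - u], 'X_[u]; split; last by rewrite -mpolyXD submK.
exists (fun t : 'I_k => if (t < a)%N then 'X_i else 'X_j); split=> [t|].
  apply/edge_primeP => v; rewrite /edge_degree.
  by case: ifP => _; rewrite msuppX inE => /eqP ->; rewrite !mnm1E eqxx ?addn1.
rewrite /u mpolyXD -!mpolyXn -(big_mkord xpredT (fun t => if (t < a)%N then 'X_i else 'X_j)).
have ak : (a <= k)%N by rewrite geq_minl.
rewrite (big_cat_nat (n := a)) //=; congr (_ * _).
  rewrite big_nat (eq_bigr (fun=> 'X_i)) => [|t /andP[_ ->] //].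
  by rewrite -big_nat prodr_const_nat subn0.
rewrite big_nat (eq_bigr (fun=> 'X_j)) => [|t /andP[ta _]].
  by rewrite -big_nat prodr_const_nat.
by rewrite ltnNge ta.
Qed.

(** The exponents of the monomials in the [k]-th symbolic power: the [k]-covers. *)
Definition kcover k : pred 'X_{1..n} :=
  fun m => [forall i, forall j, e i j ==> (k <= m i + m j)%N].

Lemma kcoverP k m :
  reflect (forall i j, e i j -> (k <= m i + m j)%N) (kcover k m).
Proof.
apply: (iffP forallP) => [h i j eij|h i].
  by have /forallP/(_ j) := h i; rewrite eij.
by apply/forallP=> j; apply/implyP/h.
Qed.

Lemma cover_idealP f : cover_ideal K e f <-> supported (kcover 1) f.
Proof.
split=> [If m mf|If i j eij].
  by apply/kcoverP=> i j eij; apply: (edge_primeP i j f).1 mf; apply: If.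
by apply/edge_primeP => m /If/kcoverP/(_ i j eij).
Qed.

Lemma cover_symbolic_powerP k f :
  cover_symbolic_power K e k f <-> supported (kcover k) f.
Proof.
have ne i j : e i j -> i != j by apply: contraTneq => ->; rewrite e_irr.
split=> [If m mf|If i j eij].
  apply/kcoverP=> i j eij; apply: (edge_prime_powerP k f (ne _ _ eij)).1 mf.
  exact: If.
by apply/edge_prime_powerP; [apply: ne | move=> m /If/kcoverP/(_ i j eij)].
Qed.

(** The set [P] of the vertices of exponent at most [k] makes the complex fibrewise
    a cone. The apex [q] over [X] is a vertex of large exponent without tight
    neighbour in [b - mset X]. An edge from [q] to a vertex of [P] keeps a
    degree of at least [2 * k] when [q] is added, as the faces over [X] all
    lower the vertices of [P] in the same way; an edge from [q] to a vertex
    outside [P] starts with a degree of at least [2 * k + 2]. *)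
Lemma kcover_acyclic k d b i :
  (forall c : 'I_n -> nat,
     (forall x y, e x y -> (2 * k <= c x + c y)%N) ->
     (forall v, (k < c v)%N -> exists2 u, e v u & (c u + c v = 2 * k)%N) ->
     (\sum_v c v <= d)%N) ->
  (d + i < mdeg b)%N ->
  @acyclic_at n K K^o
    (fun A => (mset A <= b)%MM && kcover (2 * k) (b - mset A)%MM) i.
Proof.
move=> bound db; apply: (@fibrewise_cone_acyclic _ _ _ _ [set v | (b v <= k)%N]).
  move=> A B /subsetP AB /andP[/mnm_lepP Bb /kcoverP cB].
  have ABn v : ((v \in A) <= (v \in B))%N by case vA: (v \in A) => //; rewrite AB.
  apply/andP; split.
    by apply/mnm_lepP=> v; apply: leq_trans (Bb v); rewrite !mnmE.
  apply/kcoverP=> x y /cB; rewrite !mnmBE !mnmE; move: (ABn x) (ABn y); lia.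
move=> X /subsetP XP cX /andP[Xb Xcov].
set c := (b - mset X)%MM in Xcov.
have : ~~ [forall v, (k < c v)%N ==> [exists u, e v u && (c u + c v == 2 * k)%N]].
  apply: contraTN db => /forallP h; rewrite -leqNgt.
  have -> : mdeg b = (mdeg c + #|X|)%N by rewrite -mdeg_mset -mdegD submK.
  apply: leq_add => //; rewrite mdegE; apply: bound; first exact/kcoverP.
  move=> v kv; have := h v; rewrite kv => /existsP[u /andP[vu /eqP cu]].
  by exists u.
rewrite negb_forall => /existsP[q]; rewrite negb_imply => /andP[kq noq].
have bq : (k < b q)%N by apply: leq_trans kq _; rewrite mnmBE leq_subr.
exists q; first by rewrite inE -ltnNge.
have qX : q \notin X by apply/negP=> /XP; rewrite inE leqNgt bq.
move=> A /andP[/mnm_lepP Ab /kcoverP Acov] AX.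
case qA: (q \in A).
  have -> : q |: A = A by apply/setUidPr; rewrite sub1set.
  by apply/andP; split; [apply/mnm_lepP | apply/kcoverP].
have qu u : e q u -> (2 * k <= (b q - 1) + (b u - (u \in A)))%N.
  move=> equ; case: (leqP (b u) k) => bu; last by case: (u \in A) => /=; lia.
  have -> : (u \in A) = (u \in X) by rewrite -AX !inE bu andbT.
  move: noq; rewrite negb_exists => /forallP/(_ u); rewrite equ /= => nt.
  have := kcoverP _ _ Xcov _ _ equ; move: nt; rewrite !mnmBE !mnmE (negPf qX).
  by move: (u \in X) => uX; lia.
apply/andP; split.
  apply/mnm_lepP=> v; rewrite mnmE !inE; case: eqP => [->|_] /=.
    exact: leq_ltn_trans bq.
  by have := Ab v; rewrite mnmE.
apply/kcoverP=> x y exy; rewrite !mnmBE !mnmE !inE.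
case: (x =P q) exy => [->|_] exy /=.
  case: (y =P q) exy => [->|_] exy /=; first by rewrite e_irr in exy.
  exact: qu.
case: (y =P q) exy => [->|_] exy /=; first by rewrite addnC qu // e_sym.
by have := Acov _ _ exy; rewrite !mnmBE !mnmE.
Qed.

End SymbolicPowers.

(** * Generators and regularity *)

Section CoverGenerators.
Variables (n : nat) (K : fieldType) (e : rel 'I_n).
Hypotheses (e_sym : ssrbool.symmetric e) (e_irr : irreflexive e).
Local Notation S := {mpoly K[n]}.
Implicit Types (m : 'X_{1..n}) (C : {set 'I_n}).

Lemma vertex_coverP C :
  vertex_cover e [set: 'I_n] C <-> forall x y, e x y -> (x \in C) || (y \in C).
Proof.
rewrite /vertex_cover subsetT /=; split=> [/forall_inP h x y exy|h].
  by have /forall_inP/(_ y (in_setT y)) := h x (in_setT x); rewrite exy.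
by apply/forall_inP=> x _; apply/forall_inP=> y _; apply/implyP/h.
Qed.

Lemma min_cover_private C x : min_vertex_cover e [set: 'I_n] C -> x \in C ->
  exists2 y, e x y & y \notin C.
Proof.
move=> /minsetP[/vertex_coverP cC minC] xC.
have [/existsP[y /andP[]]|] := boolP [exists y, e x y && (y \notin C)].
  by exists y.
rewrite negb_exists => /forallP noy.
have : C :\ x = C.
  apply: minC; last exact: subsetDl.
  apply/vertex_coverP=> u v euv; rewrite !inE.
  case: (u =P x) euv => [->|_] euv /=.
    have := noy v; rewrite euv negbK /= => ->.
    by case: (v =P x) euv => // ->; rewrite e_irr.
  case: (v =P x) euv => [->|_] euv /=; last exact: cC.
  by have := noy u; rewrite e_sym euv negbK orbF.
by move/setP/(_ x); rewrite !inE eqxx xC.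
Qed.

(** Each vertex of a minimal cover has a neighbour outside the cover, so none of
    the exponents of the power can be lowered. *)
Lemma min_cover_generator (I : S -> Prop) k C :
  (forall f, I f <-> supported (kcover e k) f) ->
  min_vertex_cover e [set: 'I_n] C -> min_monomial_generator I (mset C *+ k)%MM.
Proof.
move=> IP mC; have /minsetP[/vertex_coverP cC _] := mC; split.
  apply/IP/supportedX/kcoverP=> x y /cC; rewrite !mulmnE !mnmE.
  by case: (x \in C) => /= [|->]; lia.
move=> m /IP/supportedX/kcoverP mk /mnm_lepP mC'; apply/mnmP=> x.
have := mC' x; rewrite !mulmnE !mnmE; case xC: (x \in C); last by lia.
have [y exy yC] := min_cover_private mC xC.
have := mk _ _ exy; have := mC' y; rewrite mulmnE mnmE (negPf yC) mul0n.
by lia.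
Qed.

Lemma mdeg_cover_generator m : min_monomial_generator (cover_ideal K e) m ->
  exists2 C, min_vertex_cover e [set: 'I_n] C & mdeg m = #|C|.
Proof.
move=> [/cover_idealP/supportedX/kcoverP mk minm].
have le_m C : (forall x, x \in C -> (0 < m x)%N) -> (mset C <= m)%MM.
  by move=> Cm; apply/mnm_lepP=> x; rewrite mnmE; case xC: (x \in C) => //; apply: Cm.
have coverE C : (forall x, x \in C -> (0 < m x)%N) ->
    vertex_cover e [set: 'I_n] C -> mset C = m.
  move=> Cm /vertex_coverP cC; apply: minm (le_m C Cm).
  apply/cover_idealP/supportedX/kcoverP=> x y /cC; rewrite !mnmE.
  by case: (x \in C) => /= [|->].
pose C := [set x | (0 < m x)%N].
have Cm x : x \in C -> (0 < m x)%N by rewrite inE.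
have cC : vertex_cover e [set: 'I_n] C.
  by apply/vertex_coverP=> x y /mk; rewrite !inE; lia.
exists C; last by rewrite -mdeg_mset (coverE _ Cm cC).
apply/minsetP; split=> // D cD /subsetP DC.
have : mset D = mset C by rewrite !coverE // => x /DC/Cm.
move=> /mnmP DCE; apply/setP=> x; have := DCE x; rewrite !mnmE.
by case: (x \in D); case: (x \in C).
Qed.

Hypothesis wc1 : one_well_covered e.
Local Notation d := (#|'I_n| - indep_number e [set: 'I_n])%N.

Lemma min_vertex_cover_exists : exists C, min_vertex_cover e [set: 'I_n] C.
Proof.
have i0 : independent e (set0 : {set 'I_n}) by apply/independentP=> x y; rewrite inE.
have [B [_ _ _ mB]] := maximal_independent_ext (sub0set [set: 'I_n]) i0.
by exists ([set: 'I_n] :\: B).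
Qed.

Lemma ideal_deg_cover : ideal_deg (cover_ideal K e) = d%:Z.
Proof.
have card_d C : min_vertex_cover e [set: 'I_n] C -> #|C| = d.
  by move/(card_min_vertex_cover wc1) => <-; rewrite addnK.
apply: maximumE => [|x [m [/mdeg_cover_generator[C mC ->] ->]]]; last by rewrite card_d.
have [C mC] := min_vertex_cover_exists.
exists (mset C *+ 1)%MM; split; last by rewrite mdegMn mdeg_mset card_d // muln1.
by apply: min_cover_generator mC => f; apply: cover_idealP.
Qed.

Lemma symbolic_power_koszul_regular k :
  koszul_regular (fun=> 0%N) (row_ideal (cover_symbolic_power K e (2 * k))) (2 * k * d).
Proof.
move=> i w wI wi wab w0.
have wIP A := (cover_symbolic_powerP e_irr _ _).1 (wI A).
have [||A Ai|A|y [yI _ yw]] := @monomial_koszul_exact n K (kcover e (2 * k)) (2 * k * d) i _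
   (fun A => w A 0 0 : S^o).
- by move=> b; apply: kcover_acyclic => // c; apply: tight_cover_bound.
- by move=> A m mw; rewrite (wIP A m mw) -(addn0 (mdeg m)) (wab A 0 m mw).
- by rewrite wi // mxE.
- by rewrite -koszul_coord w0 mxE.
exists (fun A => \row__ y A) => A.
  apply/cover_symbolic_powerP => // m; rewrite mxE => /yI/andP[] //.
apply/rowP=> b; rewrite ord1 koszul_coord; apply: etrans (yw A).
by apply: eq_koszul => B; rewrite mxE.
Qed.

Lemma regularity_symbolic_power k :
  regularity (cover_symbolic_power K e (2 * k)) = (2 * k * d)%:Z.
Proof.
have IP f := @cover_symbolic_powerP n K e e_irr (2 * k) f.
have [C mC] := min_vertex_cover_exists.
apply: (regularityE IP (@symbolic_power_koszul_regular k)) (min_cover_generator IP mC) _.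
  move=> m1 m2 /kcoverP m2k; apply/kcoverP=> x y /m2k; rewrite !mnmDE; lia.
by rewrite mdegMn mdeg_mset -(card_min_vertex_cover wc1 mC) addnK mulnC.
Qed.

End CoverGenerators.

Theorem proposition4p11 (K : fieldType) (n : nat) (e : rel 'I_n)
    (e_sym : ssrbool.symmetric e) (e_irr : irreflexive e)
    (e_1wc : one_well_covered e) :
  [/\ gamma0 e = gamma e,
      gamma e = (ideal_deg (cover_ideal K e))%:~R
    & forall k : nat, (2 <= k)%N -> ~~ odd k ->
        regularity (cover_symbolic_power K e k)
        = k%:Z * ideal_deg (cover_ideal K e)].
Proof.
rewrite gamma0E // gammaE // ideal_deg_cover //; split=> // k _ k_even.
have -> : k = (2 * k./2)%N by rewrite mul2n even_halfK.
by rewrite regularity_symbolic_power // PoszM.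
Qed.
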